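(* Let $n \equiv 2 \pmod{4}$ and let $F$ be a bipartite directed $2$-factor of order $n$. There exists a solution to $\mathrm{OP}^*(F)$ if and only if $F \neq [6]$.
   Context: $K_n^*$ denotes the complete symmetric digraph on $n$ vertices (for every pair of distinct vertices $u,v$ both arcs $uv$ and $vu$ are present). A directed $2$-factor $[m_1,\ldots,m_t]$ of order $n=m_1+\cdots+m_t$ is a digraph consisting of vertex-disjoint directed cycles of lengths $m_1,\ldots,m_t$ (each $m_i\ge 2$; a directed $2$-cycle on $\{u,v\}$ consists of the arcs $uv$ and $vu$). It is bipartite if every $m_i$ is even. $[6]$ denotes a single directed $6$-cycle. A solution to the directed Oberwolfach problem $\mathrm{OP}^*(F)$ is a decomposition of the arc set of $K_n^*$ into pairwise arc-disjoint spanning subdigraphs, each isomorphic to $F$. *)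

(* Defs.v *)
From mathcomp Require Import all_boot.

Set Implicit Arguments.
Unset Strict Implicit.
Unset Printing Implicit Defensive.

Record digraph := Digraph { vertex :> finType; arc : rel vertex }.

Definition arcs (D : digraph) : {set D * D} := [set a | arc a.1 a.2].

Definition isomorphic (D E : digraph) : Prop :=
  exists2 f : D -> E, bijective f & forall x y, arc (f x) (f y) = arc x y.

Definition complete_symmetric (n : nat) : digraph :=
  @Digraph 'I_n (fun u v => u != v).

(* Vertices are pairs (i, j) with j < m_i; the arcs are
   (i, j) -> (i, j + 1 mod m_i). *)
Definition disjoint_dicycles (m : seq nat) : digraph :=
  @Digraph {i : 'I_(size m) & 'I_(nth 0 m i)}
    (fun x y => (tag x == tag y) &&
       (tagged y == (tagged x).+1 %% nth 0 m (tag x) :> nat)).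

Definition directed_2factor (m : seq nat) (F : digraph) : Prop :=
  all (fun k => 2 <= k) m /\ isomorphic F (disjoint_dicycles m).

Definition bipartite_directed_2factor (n : nat) (F : digraph) : Prop :=
  exists m : seq nat,
    [/\ directed_2factor m F, sumn m = n & all (fun k => ~~ odd k) m].

Definition spanning_subdigraph (D : digraph) (A : {set D * D}) : digraph :=
  @Digraph D (fun u v => (u, v) \in A).

(* A spanning subdigraph is determined by its arc set.  The members of a
   [partition] are nonempty, which is automatic for copies of a directed
   2-factor of positive order. *)
Definition decomposition (D F : digraph) (P : {set {set D * D}}) : Prop :=
  partition P (arcs D) /\
  forall A, A \in P -> isomorphic (spanning_subdigraph A) F.

Definition OP_solvable (n : nat) (F : digraph) : Prop :=
  exists P, @decomposition (complete_symmetric n) F P.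

(* Main.v *)
Require Import Defs.
From mathcomp Require Import all_boot zify.
Set Implicit Arguments.
Unset Strict Implicit.
Unset Printing Implicit Defensive.

(* Write n = 2m with m odd and let the vertex 2p + x be the copy x of the
   position p in Z_m, so that K_n^* consists of the rungs {2p, 2p + 1} and of the arcs lying over
   the edges of K_m.  For m >= 5 split the edges of K_m into the circulant C_m(1,2) and Hamilton
   cycles: the differences s, s + 1 generate a quotient of a grid, and exchanging the
   opposite sides of one square between any two consecutive rows turns the g row cycles into one
   Hamilton cycle, while the squares are placed so that the h column cycles also become one.
   The arcs over a Hamilton cycle decompose into 4 copies of F: in the
   copies, position i chooses its layer according to one of three balanced vectors of
   {0,1}^4, consecutive positions using different vectors (Haggkvist's lemma).  The rungs and the
   arcs over C_m(1,2) decompose into 9 copies of F, obtained by concatenating tiles with a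
   common interface; a cycle of arbitrary length is produced by exchanging arcs at
   the ports of adjacent tiles.  The number of copies is 9 + 4((m - 1)/2 - 2) = n - 1.
   The cases m = 1, 3 are explicit, and [6] is excluded by exhaustive search. *)

(** * Decompositions given by lists of cycles *)

(** Hamilton cycles of K_m alone would leave over the rungs, which form only the factor of 2-cycles;
    so the rungs have to be dissolved into factors together with arcs over some edges. C_m(1,2)
    suits this because its edges are local: each position contributes 2 + 16 arcs, that is, 2 arcs
    for each of 9 factors, and a tile affects only the next two positions. Three vectors are needed
    in the layers because a Hamilton cycle of K_m has odd length and neighbouring positions must
    differ. The obstacle in the grid is that every exchange of a square acts on the rows and on the
    columns at once. The surplus g - h is even since m is odd, and a gadget on three columns absorbs
    it two squares at a time. If there is one column cycle only, the gadget is applied to three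
    segments of it. Consecutive differences are paired because they are coprime, so that the grid
    reaches all of Z_m even if neither difference is a unit. *)

Definition path_arcs (T : Type) (s : seq T) := zip s (behead s).
Definition cycle_arcs (T : Type) (c : seq T) := zip c (rot 1 c).
Definition factor_arcs (T : Type) (cs : seq (seq T)) := flatten [seq cycle_arcs c | c <- cs].

Lemma isomorphic_sym (D E : digraph) : isomorphic D E -> isomorphic E D.
Proof.
case=> f [g fK gK] fA; exists g; first by exists f.
by move=> x y; rewrite -fA !gK.
Qed.

Lemma isomorphic_trans (D E H : digraph) :
  isomorphic D E -> isomorphic E H -> isomorphic D H.
Proof.
case=> f bf fA [g bg gA]; exists (g \o f); first exact: bij_comp.
by move=> x y; rewrite /= gA fA.
Qed.

(** Cycle lengths are controlled only up to order; this reorders the cycles themselves so that their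
    lengths match a given list literally. *)
Lemma perm_map_lift (S T : eqType) (f : S -> T) (s : seq S) (t : seq T) :
  perm_eq (map f s) t -> exists2 s', perm_eq s' s & map f s' = t.
Proof.
elim: t s => [|y t IH] s st.
  exists [::] => //; move/perm_nilP: st; by case: s.
have yin: y \in map f s by rewrite (perm_mem st) mem_head.
case/mapP: yin => x xs yx.
have sx := perm_to_rem xs.
have [s' s's fs'] : exists2 s', perm_eq s' (rem x s) & map f s' = t.
  apply: IH; rewrite -(perm_cons y); apply: perm_trans st.
  by rewrite yx -map_cons perm_sym; apply: perm_map.
exists (x :: s'); last by rewrite /= fs' yx.
by rewrite perm_sym; apply: (perm_trans sx); rewrite perm_cons perm_sym.
Qed.

Lemma size_cycle_arcs (T : Type) (c : seq T) : size (cycle_arcs c) = size c.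
Proof. by rewrite /cycle_arcs size_zip size_rot minnn. Qed.

Lemma unzip1_cycle_arcs (T : Type) (c : seq T) : unzip1 (cycle_arcs c) = c.
Proof. by rewrite unzip1_zip ?size_rot. Qed.

Lemma unzip1_factor_arcs (T : Type) (cs : seq (seq T)) : unzip1 (factor_arcs cs) = flatten cs.
Proof.
rewrite /unzip1 /factor_arcs map_flatten -map_comp; congr flatten.
by rewrite -[RHS]map_id; apply: eq_map => c; apply: unzip1_cycle_arcs.
Qed.

Lemma size_factor_arcs (T : Type) (cs : seq (seq T)) : size (factor_arcs cs) = size (flatten cs).
Proof. by rewrite -(unzip1_factor_arcs cs) size_map. Qed.

Lemma nth_rot1 (T : Type) (x0 : T) (c : seq T) j :
  j < size c -> nth x0 (rot 1 c) j = nth x0 c (j.+1 %% size c).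
Proof.
case: c => // x s lt_j; rewrite rot1_cons nth_rcons /= in lt_j *.
case: ltnP => h; first by rewrite modn_small.
have -> : j = size s by lia.
by rewrite eqxx modnn.
Qed.

Lemma mem_cycle_arcsP (T : eqType) (x0 : T) (c : seq T) (e : T * T) :
  reflect (exists2 j, j < size c & e = (nth x0 c j, nth x0 c (j.+1 %% size c)))
          (e \in cycle_arcs c).
Proof.
apply: (iffP (nthP (x0, x0))) => [[j]|[j lt_j ->]].
  rewrite size_cycle_arcs => lt_j <-; exists j => //.
  by rewrite /cycle_arcs nth_zip ?size_rot // nth_rot1.
exists j; first by rewrite size_cycle_arcs.
by rewrite /cycle_arcs nth_zip ?size_rot // nth_rot1.
Qed.

Lemma uniq_flatten_nth (T : eqType) (x0 : T) (cs : seq (seq T)) i j i' j' :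
  uniq (flatten cs) ->
  i < size cs -> i' < size cs ->
  j < size (nth [::] cs i) -> j' < size (nth [::] cs i') ->
  nth x0 (nth [::] cs i) j = nth x0 (nth [::] cs i') j' -> i = i' /\ j = j'.
Proof.
elim: cs i i' => [|c cs IH] [|i] [|i'] //= ; rewrite cat_uniq => /and3P[uc dis ucs].
- move=> _ _ jc j'c /eqP; rewrite nth_uniq // => /eqP; by [].
- move=> _ i's jc j's E; case/hasP: dis.
  exists (nth x0 c j); last exact: mem_nth.
  rewrite E; apply/flattenP; exists (nth [::] cs i'); exact: mem_nth.
- move=> is_ _ js j'c E; case/hasP: dis.
  exists (nth x0 c j'); last exact: mem_nth.
  rewrite -E; apply/flattenP; exists (nth [::] cs i); exact: mem_nth.
- by move=> is_ i's js j's E; case: (IH i i' ucs is_ i's js j's E) => -> ->.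
Qed.

(** The vertex (i, j) corresponds to the j-th entry of the i-th cycle. Distinctness of the entries
    gives injectivity, and counting gives bijectivity. *)
Lemma iso_of_cycles n (cs : seq (seq nat)) (A : {set 'I_n * 'I_n}) :
  perm_eq (flatten cs) (iota 0 n) ->
  (forall u v : 'I_n, ((u, v) \in A) = ((val u, val v) \in factor_arcs cs)) ->
  isomorphic (@spanning_subdigraph (complete_symmetric n) A)
             (disjoint_dicycles (map size cs)).
Proof.
move=> pcs inA; apply: isomorphic_sym.
have ucs : uniq (flatten cs) by rewrite (perm_uniq pcs) iota_uniq.
set m := map size cs.
have szn (i : 'I_(size m)) : nth 0 m i = size (nth [::] cs i).
  by rewrite (nth_map [::]) // -(size_map size cs).
have isz (i : 'I_(size m)) : i < size cs by rewrite -(size_map size cs).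
have jsz (i : 'I_(size m)) (j : 'I_(nth 0 m i)) : j < size (nth [::] cs i).
  by rewrite -szn.
pose g (x : disjoint_dicycles m) : nat := nth 0 (nth [::] cs (tag x)) (tagged x).
have g_lt (x : disjoint_dicycles m) : g x < n.
  have : g x \in flatten cs.
    apply/flattenP; exists (nth [::] cs (tag x)); first exact: mem_nth.
    by apply: mem_nth; rewrite -szn.
  by rewrite (perm_mem pcs) mem_iota.
pose f (x : disjoint_dicycles m) : complete_symmetric n := Ordinal (g_lt x).
have gI (x y : disjoint_dicycles m) : g x = g y -> x = y.
  case: x y => [i j] [i' j'] E.
  have [E1 E2] := @uniq_flatten_nth _ 0 cs i j i' j' ucs (isz i) (isz i')
    (jsz i j) (jsz i' j') E.
  have Ei : i = i' by apply: val_inj.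
  by case: i' / Ei j' E2 {E E1} => j' E2; congr (Tagged _ _); apply: val_inj.
have fI : injective f by move=> x y /(congr1 val) /gI.
exists f.
  apply: inj_card_bij => //=.
  rewrite card_ord card_tagged sumnE big_map big_enum /= .
  rewrite -(size_iota 0 n) -(perm_size pcs) size_flatten /shape sumnE.
  rewrite -/m (big_nth 0) big_mkord.
  by apply: eq_leq; apply: eq_bigr => i _; rewrite card_ord.
move=> x y; rewrite /= inA /=.
apply/flatten_mapP/andP.
  case=> c c_in /(mem_cycle_arcsP 0) [j jc [E1 E2]].
  case/(nthP [::]): c_in => i i_lt ci.
  have := @uniq_flatten_nth _ 0 cs (tag x) (tagged x) i j ucs (isz _) i_lt.
  rewrite -szn ltn_ord ci jc => /(_ isT isT E1) [tx gx].
  have := @uniq_flatten_nth _ 0 cs (tag y) (tagged y) i (j.+1 %% size c) ucs (isz _) i_lt.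
  rewrite -szn ltn_ord ci ltn_mod (leq_ltn_trans _ jc) // => /(_ isT isT E2) [ty gy].
  by split; [apply/eqP/val_inj; rewrite /= tx ty | rewrite gy gx szn tx ci].
case=> /eqP txy /eqP E.
exists (nth [::] cs (tag x)); first exact: mem_nth.
apply/(mem_cycle_arcsP 0); exists (tagged x); first by rewrite -szn.
rewrite /g -szn -E; congr (_, nth 0 (nth [::] cs _) _).
by rewrite txy.
Qed.

(** Only disjointness has to be supplied: [n.-1] spanning factors have as many arcs as there are
    ordered pairs of distinct vertices, so distinct arcs already exhaust the complete digraph. *)
Lemma OP_of_cycles n (mm : seq nat) (F : digraph) (Fs : seq (seq (seq nat))) :
  isomorphic F (disjoint_dicycles mm) -> all (leq 2) mm ->
  0 < n -> size Fs = n.-1 ->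
  (forall cs, cs \in Fs -> perm_eq (flatten cs) (iota 0 n)) ->
  (forall cs, cs \in Fs -> perm_eq (map size cs) mm) ->
  uniq (flatten (map (@factor_arcs nat) Fs)) ->
  OP_solvable n F.
Proof.
move=> isoF mm2 n_gt0 szF pF sF uF.
pose S cs := [set a : 'I_n * 'I_n | (val a.1, val a.2) \in factor_arcs cs].
have factor_arc_prop cs u v : cs \in Fs -> (u, v) \in factor_arcs cs -> [/\ u < n, v < n & u != v].
  move=> csF /flatten_mapP[c c_in e_in].
  have c_sub x : x \in c -> x < n.
    move=> xc; have : x \in flatten cs by apply/flattenP; exists c.
    by rewrite (perm_mem (pF _ csF)) mem_iota.
  have c_uniq : uniq c.
    have : uniq (flatten cs) by rewrite (perm_uniq (pF _ csF)) iota_uniq.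
    case/splitPr: c_in => s1 s2; rewrite flatten_cat /= !cat_uniq.
    by case/and3P=> _ _ /and3P[].
  have c2 : 2 <= size c.
    have : size c \in mm by rewrite -(perm_mem (sF _ csF)) map_f.
    by move/(allP mm2).
  case/(mem_cycle_arcsP 0): e_in => j jc [-> ->].
  have jc' : j.+1 %% size c < size c by rewrite ltn_mod; lia.
  split; rewrite ?c_sub ?mem_nth // nth_uniq //.
  have [h|h] := leqP (size c) j.+1; last by rewrite modn_small //; lia.
  have -> : j.+1 = size c by lia.
  rewrite modnn; lia.
pose all_arcs := [seq (u, v) | u <- iota 0 n, v <- rem u (iota 0 n)].
have sub_all : {subset flatten (map (@factor_arcs nat) Fs) <= all_arcs}.
  move=> [u v] /flatten_mapP[cs csF e_in].
  have [un vn uv] := factor_arc_prop _ _ _ csF e_in.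
  apply/allpairsPdep; exists u, v; split; rewrite ?mem_iota //.
  by rewrite rem_filter ?iota_uniq // mem_filter /= mem_iota /= vn eq_sym uv.
have [|_ eq_all] := uniq_min_size uF sub_all.
  rewrite size_allpairs_dep.
  have -> : [seq size (rem u (iota 0 n)) | u <- iota 0 n] = nseq n n.-1.
    apply: (@eq_from_nth _ 0); rewrite size_map size_iota ?size_nseq // => i lt_i.
    rewrite (nth_map 0) ?size_iota // nth_nseq lt_i nth_iota //.
    by rewrite size_rem ?mem_iota // size_iota.
  rewrite sumn_nseq size_flatten /shape -map_comp.
  have -> : [seq (size \o (@factor_arcs nat)) i | i <- Fs] = nseq n.-1 n.
    rewrite -szF; elim: (Fs) pF => // cs Fs' IH pF'; rewrite /= size_factor_arcs.
    rewrite (perm_size (pF' cs (mem_head _ _))) size_iota IH // => c cF.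
    by apply: pF'; rewrite in_cons cF orbT.
  by rewrite sumn_nseq mulnC.
have memS cs e : (e \in S cs) = ((val e.1, val e.2) \in factor_arcs cs) by rewrite inE.
exists [set A in map S Fs]; split; last first.
  move=> A; rewrite inE => /mapP[cs csF ->].
  have [cs' p_cs' s_cs'] := perm_map_lift (sF _ csF).
  apply: (@isomorphic_trans _ (disjoint_dicycles mm)); last exact: isomorphic_sym.
  rewrite -s_cs'; apply: iso_of_cycles.
    by rewrite (perm_trans _ (pF _ csF)) // perm_flatten.
  by move=> u v; rewrite memS /=; apply/esym/perm_mem/perm_flatten/perm_map.
apply/and3P; split.
- apply/eqP/setP => [[u v]]; rewrite inE /=.
  have := eq_all (val u, val v).
  have -> : ((val u, val v) \in all_arcs) = (u != v).
    apply/allpairsPdep/idP => [[u' [v' [_ + [E1 E2]]]]|uv].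
      rewrite -E1 -E2 => v'in; move: v'in.
      by rewrite rem_filter ?iota_uniq // mem_filter /= eq_sym => /andP[].
    exists (val u), (val v); split; rewrite ?mem_iota //=.
    by rewrite rem_filter ?iota_uniq // mem_filter /= mem_iota /= ltn_ord eq_sym andbT.
  move=> <-; apply/bigcupP/flatten_mapP => [[A]|[cs csF e_in]].
    by rewrite inE => /mapP[cs csF ->]; rewrite memS; exists cs.
  by exists (S cs); rewrite ?memS // inE map_f.
- apply/trivIsetP => A B; rewrite !inE => /mapP[cs csF ->] /mapP[cs' cs'F ->] neq.
  apply/pred0P => e; rewrite /= !memS; apply/negP => /andP[e1 e2].
  case/eqP: neq; congr S.
  elim: (Fs) uF csF cs'F => //= c0 Fs' IH; rewrite cat_uniq => /and3P[_ /hasPn dis uF'].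
  rewrite !in_cons => /orP[/eqP c1|csF] /orP[/eqP c2|cs'F].
  + by rewrite c1.
  + have /negP[] := dis _ (introT flatten_mapP (ex_intro2 _ _ cs' cs'F e2)).
    by rewrite -c1.
  + have /negP[] := dis _ (introT flatten_mapP (ex_intro2 _ _ cs csF e1)).
    by rewrite -c2.
  + exact: IH.
- rewrite inE; apply/mapP => [[cs csF E]].
  have sz : size (factor_arcs cs) = n by rewrite size_factor_arcs (perm_size (pF _ csF)) size_iota.
  case f_eq: (factor_arcs cs) sz => [|[u v] s] sz; first by rewrite -sz in n_gt0.
  have e_in : (u, v) \in factor_arcs cs by rewrite f_eq mem_head.
  have [un vn _] := factor_arc_prop _ _ _ csF e_in.
  have : (Ordinal un, Ordinal vn) \in S cs by rewrite memS.
  by rewrite -E inE.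
Qed.

Lemma uniq_flatten_map (I T : eqType) (F : I -> seq T) (s : seq I) :
  uniq s -> {in s, forall j, uniq (F j)} ->
  {in s &, forall j j' e, e \in F j -> e \in F j' -> j = j'} ->
  uniq (flatten [seq F j | j <- s]).
Proof.
elim: s => //= j s IH /andP[js us] uF dis; rewrite cat_uniq uF ?mem_head //=.
rewrite IH ?andbT //; first last.
- by move=> a b a_s b_s; apply: dis; rewrite in_cons ?a_s ?b_s orbT.
- by move=> a a_s; apply: uF; rewrite in_cons a_s orbT.
apply/hasPn => e /flatten_mapP[a a_s ea]; apply/negP => ej.
have E := dis j a (mem_head _ _) _ e ej ea.
by rewrite E in js; [rewrite a_s in js | rewrite in_cons a_s orbT].
Qed.

Definition swap (T : Type) (e : T * T) := (e.2, e.1).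
Definition sym_arcs (T : Type) (c : seq T) := cycle_arcs c ++ map (@swap T) (cycle_arcs c).

Lemma path_arcs_rev (T : Type) (s : seq T) : path_arcs (rev s) = rev (map (@swap T) (path_arcs s)).
Proof.
have E (t : seq T) x y : path_arcs (rcons (rcons t y) x) = rcons (path_arcs (rcons t y)) (y, x).
  by elim: t => [|a [|b t] IH] //=; rewrite -IH.
elim: s => [|x [|y s] IH] //=; rewrite !rev_cons in IH *.
by rewrite E IH.
Qed.

(** * Tiles for the circulant C_m(1,2) *)

(* [lia] is impractically slow on these goals unless the atoms are generalized. *)
Ltac lia_count :=
  repeat match goal with |- context [count ?a ?b] => move: (count a b) => ? end;
  repeat match goal with |- context [nat_of_bool ?b] => move: (nat_of_bool b) => ? end;
  lia.

Definition shift_arcs d (es : seq (nat * nat)) := [seq (d + e.1, d + e.2) | e <- es].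

(* The arcs inside position 0 and between position 0 and the positions 1 and 2. *)
Definition strip_cell : seq (nat * nat) :=
  [:: (0, 1); (1, 0)] ++ [seq (x, y) | x <- [:: 0; 1], y <- [:: 2; 3; 4; 5]]
                      ++ [seq (y, x) | x <- [:: 0; 1], y <- [:: 2; 3; 4; 5]].
Definition strip l := flatten [seq shift_arcs p.*2 strip_cell | p <- iota 0 l].

(* The vertices at the beginning of a tile that the factor j does not cover, since
   the preceding tile does; a tile of length l covers their translates by 2l instead, so that
   tiles can be concatenated and closed up modulo 2m. *)
Definition interfaces : seq (seq nat) :=
  [:: [:: 0]; [:: 0]; [:: 1]; [:: 0; 1]; [:: 0; 1]; [:: 2]; [:: 2]; [:: 3]; [:: 1; 3]].
Definition interface j := nth [::] interfaces j.
Definition factor_ids := iota 0 9.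

(* The arc uL j -> aL j of the left tile and the arc uR j -> aR j of the right
   tile may be exchanged for uL j -> aR j and uR j -> aL j simultaneously in all nine
   factors.  The left ones are written relative to two positions before the
   boundary, so that they are natural numbers. *)
Definition uLs := [:: 4; 4; 5; 5; 4; 6; 6; 7; 5].
Definition aLs := [:: 0; 3; 0; 3; 2; 3; 2; 2; 2].
Definition uRs := [:: 1; 1; 0; 2; 2; 0; 3; 1; 0].
Definition aRs := [:: 4; 2; 5; 4; 5; 4; 5; 5; 2].
Definition uL := nth 0 uLs.
Definition aL := nth 0 aLs.
Definition uR := nth 0 uRs.
Definition aR := nth 0 aRs.

(** The two multisets agree only over the nine factors together: an arc given up by one factor is
    taken over by another. This is a finite check at [k = 0], then translated. The offset 4 is the
    boundary, two positions after the origin of the left ports. *)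
Lemma port_exchange k :
  perm_eq (flatten [seq [:: (k + uL j, k + (4 + aR j)); (k + (4 + uR j), k + aL j)] | j <- factor_ids])
          (flatten [seq [:: (k + uL j, k + aL j); (k + (4 + uR j), k + (4 + aR j))] | j <- factor_ids]).
Proof.
have E (f g h i : nat -> nat) :
    flatten [seq [:: (k + f j, k + g j); (k + h j, k + i j)] | j <- factor_ids] =
    shift_arcs k (flatten [seq [:: (f j, g j); (h j, i j)] | j <- factor_ids]) by [].
by rewrite !E; apply: perm_map; vm_compute.
Qed.

(** Vertices are plain numbers, not yet reduced modulo [2m], so arcs of the last two positions may
    lead out of the tile; the reduction takes place once, in [strip_factors]. *)
Definition tiling (lam : seq nat) (c : nat -> seq (seq nat)) :=
  let l := sumn lam in
  [/\ {in factor_ids, forall j, perm_eq (interface j ++ flatten (c j))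
                          (iota 0 l.*2 ++ map (addn l.*2) (interface j))},
      perm_eq (flatten [seq factor_arcs (c j) | j <- factor_ids]) (strip l)
    & {in factor_ids, forall j, perm_eq (map size (c j)) (map double lam)}].
Definition tiled lam := exists c, tiling lam c.

Definition tilingb lam (c : seq (seq (seq nat))) :=
  let l := sumn lam in
  [&& all (fun j => perm_eq (interface j ++ flatten (nth [::] c j))
                       (iota 0 l.*2 ++ map (addn l.*2) (interface j))) factor_ids,
      perm_eq (flatten [seq factor_arcs (nth [::] c j) | j <- factor_ids]) (strip l)
    & all (fun j => perm_eq (map size (nth [::] c j)) (map double lam)) factor_ids].

Lemma tilingP lam c : tilingb lam c -> tiling lam (fun j => nth [::] c j).
Proof. by case/and3P=> /allP h1 h2 /allP h3; split. Qed.

Lemma count_flatten_map (T : Type) (P : pred T) (I : eqType) (f : I -> seq T) (s : seq I) :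
  count P (flatten [seq f j | j <- s]) = \sum_(j <- s) count P (f j).
Proof. by rewrite count_flatten -map_comp sumnE big_map. Qed.

Lemma perm_count (T : eqType) (s1 s2 : seq T) :
  perm_eq s1 s2 -> forall P, count P s1 = count P s2.
Proof. by move/permP. Qed.

Lemma path_arcs_cat (T : Type) (x y : T) s t :
  path_arcs ((x :: s) ++ y :: t) = path_arcs (x :: s) ++ (last x s, y) :: path_arcs (y :: t).
Proof. by elim: s x => [|z s IH] x //=; rewrite -IH. Qed.

Lemma cycle_arcs_cons (T : Type) (x : T) s : cycle_arcs (x :: s) = rcons (path_arcs (x :: s)) (last x s, x).
Proof.
rewrite /cycle_arcs /path_arcs rot1_cons [behead _]/=.
suff E z : zip (x :: s) (rcons s z) = rcons (zip (x :: s) s) (last x s, z) by [].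
by elim: s x => [|y s IH] x //; rewrite rcons_cons /= -IH.
Qed.

Lemma path_arcs_map (S T : Type) (f : S -> T) s :
  path_arcs (map f s) = [seq (f e.1, f e.2) | e <- path_arcs s].
Proof. by elim: s => [|x [|y s] IH] //=; rewrite -IH. Qed.

Lemma cycle_arcs_map (S T : Type) (f : S -> T) c :
  cycle_arcs (map f c) = [seq (f e.1, f e.2) | e <- cycle_arcs c].
Proof.
case: c => // x s; rewrite map_cons !cycle_arcs_cons -map_cons path_arcs_map map_rcons /=.
by rewrite last_map.
Qed.

Lemma factor_arcs_map (S T : Type) (f : S -> T) cs :
  factor_arcs (map (map f) cs) = [seq (f e.1, f e.2) | e <- factor_arcs cs].
Proof.
rewrite /factor_arcs map_flatten -!map_comp; congr flatten.
by apply: eq_map => c; apply: cycle_arcs_map.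
Qed.

Lemma factor_arcs_cat (T : Type) (c d : seq (seq T)) : factor_arcs (c ++ d) = factor_arcs c ++ factor_arcs d.
Proof. by rewrite /factor_arcs map_cat flatten_cat. Qed.

Lemma shift_arcs_comp d d' es : shift_arcs d (shift_arcs d' es) = shift_arcs (d + d') es.
Proof. by rewrite /shift_arcs -map_comp; apply: eq_map => e /=; rewrite !addnA. Qed.

Lemma strip_cat l l' : strip (l + l') = strip l ++ shift_arcs l.*2 (strip l').
Proof.
rewrite /strip iotaD map_cat flatten_cat; congr (_ ++ _).
have -> ss : shift_arcs l.*2 (flatten ss) = flatten (map (shift_arcs l.*2) ss) by exact: map_flatten.
rewrite -map_comp add0n -[in LHS](addn0 l) iotaDl -map_comp; congr flatten.
by apply: eq_map => p; rewrite -[RHS]/(shift_arcs l.*2 (shift_arcs p.*2 strip_cell)) shift_arcs_comp -doubleD.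
Qed.

Lemma perm_iota_double l l' :
  iota 0 (l + l').*2 = iota 0 l.*2 ++ map (addn l.*2) (iota 0 l'.*2).
Proof. by rewrite doubleD iotaD add0n -iotaDl addn0. Qed.

Lemma tiled_nil : tiled [::].
Proof. by exists (fun=> [::]); split=> // j _; rewrite /= cats0 map_id perm_refl. Qed.

Lemma map_addn_comp a b s : map (addn a) (map (addn b) s) = map (addn (a + b)) s.
Proof. by rewrite -map_comp; apply: eq_map => x /=; rewrite addnA. Qed.

(** Translation by [l.*2] turns the interface that the first tile covers in advance into the one
    that the second tile omits, so the vertex conditions telescope. *)
Lemma tiled_cat lam lam' : tiled lam -> tiled lam' -> tiled (lam ++ lam').
Proof.
case=> c [c1 c2 c3] [c' [c'1 c'2 c'3]].
set l := sumn lam in c1 c2; set l' := sumn lam' in c'1 c'2.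
exists (fun j => c j ++ map (map (addn l.*2)) (c' j)).
rewrite /tiling sumn_cat -/l -/l'; split.
- move=> j jin; rewrite flatten_cat -map_flatten catA.
  apply: (perm_trans (perm_cat (c1 j jin) (perm_refl _))).
  rewrite perm_iota_double -!catA perm_cat2l -map_cat doubleD -map_addn_comp -map_cat.
  exact/perm_map/c'1.
- rewrite strip_cat; apply/permP => P.
  set P' := preim (fun e : nat * nat => (l.*2 + e.1, l.*2 + e.2)) P.
  rewrite count_flatten_map count_cat /shift_arcs count_map.
  rewrite -(perm_count c2) -(perm_count c'2) !count_flatten_map.
  rewrite -big_split /=; apply: eq_bigr => j _.
  by rewrite factor_arcs_cat factor_arcs_map count_cat count_map addnC.
- move=> j jin; rewrite !map_cat -map_comp perm_cat ?c3 //.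
  by rewrite (eq_map (g := size)) ?c'3 // => s /=; rewrite size_map.
Qed.

Lemma tiled_perm lam lam' : perm_eq lam lam' -> tiled lam -> tiled lam'.
Proof.
move=> p [c [c1 c2 c3]]; exists c; rewrite /tiling -(perm_sumn p); split=> // j jin.
by apply: (perm_trans (c3 j jin)); apply: perm_map.
Qed.

(* The factor j of an open tile has the closed cycles D j, of half-lengths ext, and a
   path Q j on 2q vertices that is closed by the left port arc, located at the last two positions
   of the tile. *)
Definition open ext q (D : nat -> seq (seq nat)) (Q : nat -> seq nat) :=
  let l := sumn ext + q in
  [/\ 2 <= l,
      {in factor_ids, forall j, perm_eq (interface j ++ flatten (D j) ++ Q j)
                          (iota 0 l.*2 ++ map (addn l.*2) (interface j))},
      perm_eq (flatten [seq (l.-2.*2 + uL j, l.-2.*2 + aL j) :: factor_arcs (D j) ++ path_arcs (Q j)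
                       | j <- factor_ids]) (strip l),
      {in factor_ids, forall j, perm_eq (map size (D j)) (map double ext) /\ size (Q j) = q.*2}
    & {in factor_ids, forall j, exists2 s, Q j = l.-2.*2 + aL j :: s
                                 & last (l.-2.*2 + aL j) s = l.-2.*2 + uL j}].
Definition opened ext q := exists D Q, open ext q D Q.

Definition openb ext q (D : seq (seq (seq nat))) (Q : seq (seq nat)) :=
  let l := sumn ext + q in
  [&& 2 <= l,
      all (fun j => perm_eq (interface j ++ flatten (nth [::] D j) ++ nth [::] Q j)
                          (iota 0 l.*2 ++ map (addn l.*2) (interface j))) factor_ids,
      perm_eq (flatten [seq (l.-2.*2 + uL j, l.-2.*2 + aL j)
                            :: factor_arcs (nth [::] D j) ++ path_arcs (nth [::] Q j)
                       | j <- factor_ids]) (strip l),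
      all (fun j => perm_eq (map size (nth [::] D j)) (map double ext) &&
                    (size (nth [::] Q j) == q.*2)) factor_ids
    & all (fun j => (nth [::] Q j != [::]) && (head 0 (nth [::] Q j) == l.-2.*2 + aL j) &&
                    (last 0 (nth [::] Q j) == l.-2.*2 + uL j)) factor_ids].

Lemma openP ext q D Q : openb ext q D Q -> opened ext q.
Proof.
case/and5P=> h1 /allP h2 h3 /allP h4 /allP h5.
exists (fun j => nth [::] D j), (fun j => nth [::] Q j); split=> // j jin.
- by case/andP: (h4 j jin) => ? /eqP.
- move: (h5 j jin); case: (nth _ _ _) => // x s /= /andP[/eqP-> /eqP ls].
  by exists s.
Qed.

(** The cycle is listed from [aR j] to [uR j], so that its closing arc is the right port arc and the
    list is the path left when that arc is broken. *)
Definition single (R : seq (seq nat)) r :=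
  tilingb [:: r] [seq [:: c] | c <- R] &&
  all (fun j => (head 0 (nth [::] R j) == aR j) && (last 0 (nth [::] R j) == uR j)) factor_ids.

Lemma singleP R r : 0 < r -> single R r ->
  let f := nth [::] R in
  [/\ {in factor_ids, forall j, perm_eq (interface j ++ f j) (iota 0 r.*2 ++ map (addn r.*2) (interface j))},
      perm_eq (flatten [seq (uR j, aR j) :: path_arcs (f j) | j <- factor_ids]) (strip r)
    & {in factor_ids, forall j, size (f j) = r.*2 /\
         exists2 s, f j = aR j :: s & last (aR j) s = uR j}].
Proof.
move=> r0 /andP[/tilingP[c1 c2 c3] /allP h] f.
have Er : sumn [:: r] = r by rewrite /= addn0.
rewrite Er in c1 c2.
have szR j : j \in factor_ids -> j < size R.
  move=> jin; rewrite ltnNge; apply/negP => le_j.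
  by have /perm_size := c3 j jin; rewrite nth_default ?size_map.
have nthR j : j \in factor_ids -> nth [::] [seq [:: c] | c <- R] j = [:: f j].
  by move=> jin; rewrite (nth_map [::]) ?szR.
have fsz j : j \in factor_ids -> size (f j) = r.*2.
  move=> jin; have := c3 j jin; rewrite nthR //= => /perm_mem/(_ (size (f j))).
  by rewrite !inE eqxx => /esym/eqP.
have fs j : j \in factor_ids -> exists2 s, f j = aR j :: s & last (aR j) s = uR j.
  move=> jin; move: (h j jin) (fsz j jin); rewrite -/f; case: (f j) => [|x s] /=.
    by move=> _ E; move: r0; rewrite -double_gt0 -E.
  by case/andP=> /eqP-> /eqP <- _; exists s.
split.
- by move=> j jin; have := c1 j jin; rewrite nthR //= cats0.
- apply: perm_trans c2; apply/permP => P; rewrite !count_flatten_map.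
  rewrite [LHS]big_seq_cond [RHS]big_seq_cond; apply: eq_bigr => j /andP[jin _].
  rewrite nthR // /factor_arcs /= cats0; case: (fs j jin) => s -> ls.
  by rewrite cycle_arcs_cons ls -cats1 !count_cat /= addn0 addnC.
- by move=> j jin; split; [apply: fsz | apply: fs].
Qed.

(** Breaking the right port arc of the cycle and trading it, with the pending left port arc, for the
    two crossing arcs joins path and cycle into one cycle. Summed over the factors, [port_exchange]
    leaves the arcs unchanged. *)
Lemma open_close ext q R r :
  opened ext q -> 0 < r -> single R r -> tiled (q + r :: ext).
Proof.
case=> D [Q [l2 o1 o2 o3 o4]] r0 /(singleP r0); set f := nth [::] R => -[s1 s2 s3].
set l := sumn ext + q in l2 o1 o2 o4; set k := l.-2.*2 in o2 o4.
have kl : l.*2 = k + 4 by rewrite /k; lia.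
have El : sumn (q + r :: ext) = l + r by rewrite /= /l; lia.
exists (fun j => (Q j ++ map (addn l.*2) (f j)) :: D j); rewrite /tiling El; split.
- move=> j jin /=; rewrite perm_iota_double doubleD -map_addn_comp -!catA -map_cat.
  apply: (@perm_trans _ ((interface j ++ flatten (D j) ++ Q j) ++ map (addn l.*2) (f j))).
    by apply/permP => P; rewrite !count_cat; lia.
  apply: (perm_trans (perm_cat (o1 j jin) (perm_refl _))).
  by rewrite -!catA perm_cat2l -map_cat; apply/perm_map/s1.
- rewrite strip_cat; apply/permP => P.
  set P' := preim (fun e : nat * nat => (l.*2 + e.1, l.*2 + e.2)) P.
  rewrite count_flatten_map count_cat /shift_arcs count_map -/P'.
  rewrite -(perm_count o2) -(perm_count s2) !count_flatten_map.
  have := perm_count (port_exchange k) P; rewrite !count_flatten_map => pe.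
  have E j : j \in factor_ids -> count P (factor_arcs ((Q j ++ [seq l.*2 + i | i <- f j]) :: D j)) =
      count P [:: (k + uL j, k + (4 + aR j)); (k + (4 + uR j), k + aL j)] +
      (count P (factor_arcs (D j) ++ path_arcs (Q j)) + count P' (path_arcs (f j))).
    move=> jin; have [s -> ls] := o4 j jin; have [_ [s' -> ls']] := s3 j jin.
    rewrite /factor_arcs /= count_cat cycle_arcs_cons -cat_cons path_arcs_cat.
    rewrite last_cat /= last_map ls ls' -cats1 !count_cat /= -map_cons path_arcs_map count_map.
    rewrite -/P' kl -!addnA; lia_count.
  rewrite big_seq_cond (eq_bigr _ (fun j jin => E j (proj1 (andP jin)))) -big_seq_cond.
  rewrite big_split /= pe -big_split /= -big_split /=; apply: eq_bigr => j _.
  by rewrite /P' /= kl -!addnA !count_cat; lia_count.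
- move=> j jin; have [o3a o3b] := o3 j jin; have [szf _] := s3 j jin.
  by rewrite /= size_cat size_map szf o3b doubleD perm_cons.
Qed.

(** The attached tile of length 3 carries both ports: the right one is its closing arc, the left one
    separates [M1] from [M2]. Inserting the old path at the right port gives [M2], [Q], [M1], open
    at the left port of the new tile. The offset 2 is [3.-2.*2]. *)
Lemma open_step ext q (M1 M2 : seq (seq nat)) :
  opened ext q ->
  single [seq nth [::] M1 j ++ nth [::] M2 j | j <- factor_ids] 3 ->
  all (fun j => [&& nth [::] M1 j != [::], nth [::] M2 j != [::],
                    last 0 (nth [::] M1 j) == 2 + uL j
                  & head 0 (nth [::] M2 j) == 2 + aL j]) factor_ids ->
  opened ext (q + 3).
Proof.
case=> D [Q [l2 o1 o2 o3 o4]] sM /allP hM.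
have [] := singleP (isT : 0 < 3) sM.
set f := nth [::] _ => s1 s2 s3.
have fE j : j \in factor_ids -> f j = nth [::] M1 j ++ nth [::] M2 j.
  move=> jin; have j9 : j < 9 by move: jin; rewrite /factor_ids mem_iota.
  by rewrite /f (nth_map 0) ?size_iota // nth_iota.
set l := sumn ext + q in l2 o1 o2 o4; set k := l.-2.*2 in o2 o4.
have kl : l.*2 = k + 4 by rewrite /k; lia.
have El : sumn ext + (q + 3) = l + 3 by rewrite /l; lia.
have Ek : (l + 3).-2.*2 = l.*2 + 2 by lia.
have fM j : j \in factor_ids -> exists x1 x2 y1 y2,
    [/\ nth [::] M1 j = x1 :: y1, nth [::] M2 j = x2 :: y2, x1 = aR j,
        last x1 y1 = 2 + uL j & x2 = 2 + aL j /\ last x2 y2 = uR j].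
  move=> jin; have [_ [s fs ls]] := s3 j jin; move: fs (hM j jin) ls; rewrite fE //.
  case: (nth [::] M1 j) => // x1 y1; case: (nth [::] M2 j) => // x2 y2.
  rewrite cat_cons => -[-> <-] /and4P[_ _ /eqP l1 /eqP /= h2].
  by rewrite last_cat /= => l3; exists (aR j), x2, y1, y2.
exists D, (fun j => map (addn l.*2) (nth [::] M2 j) ++ Q j ++ map (addn l.*2) (nth [::] M1 j)).
rewrite /open El Ek; split.
- lia.
- move=> j jin; rewrite perm_iota_double doubleD -map_addn_comp -!catA -map_cat.
  apply: (@perm_trans _ ((interface j ++ flatten (D j) ++ Q j) ++ map (addn l.*2) (f j))).
    by rewrite fE // map_cat; apply/permP => P; rewrite !count_cat; lia.
  apply: (perm_trans (perm_cat (o1 j jin) (perm_refl _))).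
  by rewrite -!catA perm_cat2l -map_cat; apply/perm_map/s1.
- rewrite strip_cat; apply/permP => P.
  set P' := preim (fun e : nat * nat => (l.*2 + e.1, l.*2 + e.2)) P.
  rewrite count_flatten_map count_cat /shift_arcs count_map -/P'.
  rewrite -(perm_count o2) -(perm_count s2) !count_flatten_map.
  have := perm_count (port_exchange k) P; rewrite !count_flatten_map => pe.
  pose F j := count P (factor_arcs (D j) ++ path_arcs (Q j)) + count P' (path_arcs (nth [::] M1 j)) +
              count P' (path_arcs (nth [::] M2 j)) + P (l.*2 + 2 + uL j, l.*2 + 2 + aL j).
  pose G1 j := count P [:: (k + uL j, k + (4 + aR j)); (k + (4 + uR j), k + aL j)].
  transitivity (\sum_(j <- factor_ids) (G1 j + F j)).
    rewrite big_seq_cond [RHS]big_seq_cond; apply: eq_bigr => j /andP[jin _].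
    have [x1 [x2 [y1 [y2 [E1 E2 E3 l1 [E4 l3]]]]]] := fM j jin.
    have [s Es ls] := o4 j jin; rewrite /F /G1 E1 E2 Es.
    rewrite !map_cons !path_arcs_cat -!map_cons !path_arcs_map /= !last_map ls l3 E3.
    rewrite /P' kl -!addnA !count_cat /= !count_cat /= !count_map; lia_count.
  rewrite big_split /= /G1 pe -!big_split /=.
  rewrite big_seq_cond [RHS]big_seq_cond; apply: eq_bigr => j /andP[jin _].
  have [x1 [x2 [y1 [y2 [E1 E2 E3 l1 [E4 l3]]]]]] := fM j jin.
  rewrite /F fE // E1 E2 path_arcs_cat l1 E4 /P' /= kl -!addnA !count_cat /=.
  by rewrite -!addnA; lia_count.
- move=> j jin; have [o3a o3b] := o3 j jin; split=> //.
  have [szf _] := s3 j jin; rewrite fE // size_cat in szf.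
  by rewrite !size_cat !size_map o3b; lia.
- move=> j jin; have [x1 [x2 [y1 [y2 [E1 E2 E3 l1 [E4 l3]]]]]] := fM j jin.
  rewrite E1 E2 E4 /= -addnA.
  exists (map (addn l.*2) y2 ++ Q j ++ map (addn l.*2) (x1 :: y1)) => //.
  by rewrite !last_cat /= last_map l1 addnA.
Qed.

Lemma opened_tiled ext q : opened ext q -> tiled (q :: ext).
Proof.
case=> D [Q [l2 o1 o2 o3 o4]]; exists (fun j => Q j :: D j).
rewrite /tiling [sumn _]/= addnC; split.
- move=> j jin /=; apply: perm_trans (o1 j jin).
  by apply/permP => P; rewrite !count_cat; lia.
- apply: perm_trans o2; apply/permP => P; rewrite !count_flatten_map.
  rewrite big_seq_cond [RHS]big_seq_cond; apply: eq_bigr => j /andP[jin _].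
  have [s Es ls] := o4 j jin.
  by rewrite /factor_arcs /= Es cycle_arcs_cons ls -cats1 !count_cat /=; lia_count.
- by move=> j jin; have [o3a o3b] := o3 j jin; rewrite /= o3b perm_cons.
Qed.

Lemma single_tiled R r : single R r -> tiled [:: r].
Proof. by case/andP=> /tilingP h _; eexists; apply: h. Qed.

(* The tables below were found by computer search. *)
Definition M3 : seq (seq nat) :=
  [:: [:: 4; 5; 3; 6; 2; 1]; [:: 2; 6; 5; 4; 3; 1]; [:: 5; 7; 2; 3; 4; 0]; [:: 4; 6; 3; 7; 5; 2];
   [:: 5; 6; 4; 7; 3; 2]; [:: 4; 8; 5; 1; 3; 0]; [:: 5; 8; 4; 1; 0; 3]; [:: 5; 9; 4; 2; 0; 1]; [::
   2; 7; 4; 9; 5; 0]].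
Definition M3cut : seq nat := [:: 4; 2; 2; 4; 2; 2; 2; 2; 2].
Definition R4 : seq (seq nat) :=
  [:: [:: 4; 3; 7; 8; 6; 5; 2; 1]; [:: 2; 6; 8; 5; 4; 7; 3; 1]; [:: 5; 9; 6; 7; 2; 3; 4; 0]; [:: 4;
   8; 7; 9; 5; 3; 6; 2]; [:: 5; 8; 4; 9; 7; 6; 3; 2]; [:: 4; 6; 10; 7; 5; 1; 3; 0]; [:: 5; 7; 10; 6;
   4; 1; 0; 3]; [:: 5; 6; 11; 7; 4; 2; 0; 1]; [:: 2; 7; 11; 6; 9; 4; 5; 0]].
Definition R5 : seq (seq nat) :=
  [:: [:: 4; 7; 10; 9; 8; 5; 3; 6; 2; 1]; [:: 2; 6; 10; 8; 9; 7; 5; 4; 3; 1]; [:: 5; 2; 3; 7; 11; 9;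
   6; 8; 4; 0]; [:: 4; 8; 10; 6; 5; 9; 11; 7; 3; 2]; [:: 5; 8; 11; 6; 3; 4; 9; 10; 7; 2]; [:: 4; 6;
   7; 8; 12; 9; 5; 1; 3; 0]; [:: 5; 6; 9; 12; 8; 7; 4; 1; 0; 3]; [:: 5; 7; 9; 13; 8; 6; 4; 2; 0; 1];
   [:: 2; 7; 6; 11; 8; 13; 9; 4; 5; 0]].
Definition D13 : seq (seq (seq nat)) :=
  [:: [:: [:: 2; 7]]; [:: [:: 1; 2]]; [:: [:: 2; 5]]; [:: [:: 5; 8]]; [:: [:: 5; 9]]; [:: [:: 1;
   5]]; [:: [:: 0; 5]]; [:: [:: 0; 1]]; [:: [:: 0; 2]]].
Definition Q13 : seq (seq nat) :=
  [:: [:: 4; 1; 3; 5; 6; 8]; [:: 7; 6; 5; 3; 4; 8]; [:: 4; 0; 3; 6; 7; 9]; [:: 7; 4; 3; 2; 6; 9];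
   [:: 6; 4; 2; 3; 7; 8]; [:: 7; 3; 0; 4; 6; 10]; [:: 6; 3; 1; 4; 7; 10]; [:: 6; 2; 4; 5; 7; 11];
   [:: 6; 11; 7; 5; 4; 9]].
Definition D111 : seq (seq (seq nat)) :=
  [:: [:: [:: 1; 5]; [:: 3; 4]]; [:: [:: 1; 4]; [:: 2; 3]]; [:: [:: 0; 3]; [:: 4; 5]]; [:: [:: 2;
   4]; [:: 3; 6]]; [:: [:: 2; 5]; [:: 3; 7]]; [:: [:: 0; 4]; [:: 1; 3]]; [:: [:: 0; 1]; [:: 3; 5]];
   [:: [:: 0; 5]; [:: 1; 2]]; [:: [:: 0; 2]; [:: 5; 9]]].
Definition Q111 : seq (seq nat) :=
  [:: [:: 2; 6]; [:: 5; 6]; [:: 2; 7]; [:: 5; 7]; [:: 4; 6]; [:: 5; 8]; [:: 4; 8]; [:: 4; 9]; [:: 4;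
   7]].
Definition D24 : seq (seq (seq nat)) :=
  [:: [:: [:: 4; 6; 11; 9]]; [:: [:: 1; 3; 6; 4]]; [:: [:: 0; 3; 4; 5]]; [:: [:: 2; 4; 7; 3]]; [::
   [:: 2; 6; 3; 5]]; [:: [:: 0; 4; 3; 1]]; [:: [:: 0; 1; 5; 3]]; [:: [:: 0; 2; 1; 4]]; [:: [:: 0; 5;
   4; 2]]].
Definition Q24 : seq (seq nat) :=
  [:: [:: 8; 5; 1; 2; 3; 7; 10; 12]; [:: 11; 10; 7; 2; 5; 8; 9; 12]; [:: 8; 6; 2; 7; 9; 10; 11; 13];
   [:: 11; 12; 9; 5; 6; 10; 8; 13]; [:: 10; 13; 9; 11; 7; 4; 8; 12]; [:: 11; 6; 7; 5; 9; 8; 10; 14];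
   [:: 10; 6; 8; 4; 9; 7; 11; 14]; [:: 10; 9; 6; 5; 7; 8; 11; 15]; [:: 10; 15; 11; 8; 7; 6; 9; 13]].
Definition T22 : seq (seq (seq nat)) :=
  [:: [:: [:: 1; 2; 3; 4]; [:: 5; 8; 7; 6]]; [:: [:: 1; 5; 7; 2]; [:: 3; 6; 8; 4]]; [:: [:: 0; 4; 5;
   3]; [:: 2; 7; 9; 6]]; [:: [:: 2; 4; 9; 5]; [:: 3; 7; 8; 6]]; [:: [:: 2; 6; 7; 3]; [:: 4; 8; 5;
   9]]; [:: [:: 0; 3; 1; 4]; [:: 5; 6; 10; 7]]; [:: [:: 0; 1; 3; 5]; [:: 4; 7; 10; 6]]; [:: [:: 0;
   2; 5; 1]; [:: 4; 6; 11; 7]]; [:: [:: 0; 5; 4; 2]; [:: 6; 9; 7; 11]]].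
Definition T112 : seq (seq (seq nat)) :=
  [:: [:: [:: 1; 4]; [:: 2; 7]; [:: 3; 5; 8; 6]]; [:: [:: 1; 3]; [:: 2; 4]; [:: 5; 7; 6; 8]]; [::
   [:: 0; 4; 5; 3]; [:: 2; 6]; [:: 7; 9]]; [:: [:: 2; 5]; [:: 3; 4; 8; 7]; [:: 6; 9]]; [:: [:: 2;
   3]; [:: 4; 6; 7; 8]; [:: 5; 9]]; [:: [:: 0; 1]; [:: 3; 6; 5; 4]; [:: 7; 10]]; [:: [:: 0; 3; 7;
   4]; [:: 1; 5]; [:: 6; 10]]; [:: [:: 0; 5]; [:: 1; 2]; [:: 4; 7; 11; 6]]; [:: [:: 0; 2]; [:: 4;
   9]; [:: 5; 6; 11; 7]]].
Definition T122 : seq (seq (seq nat)) :=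
  [:: [:: [:: 1; 2; 5; 4]; [:: 3; 6; 9; 7]; [:: 8; 10]]; [:: [:: 1; 4; 2; 3]; [:: 5; 6]; [:: 7; 8;
   9; 10]]; [:: [:: 0; 3; 7; 2]; [:: 4; 8; 5; 9]; [:: 6; 11]]; [:: [:: 2; 4; 5; 3]; [:: 6; 10; 9;
   8]; [:: 7; 11]]; [:: [:: 2; 7; 10; 6]; [:: 3; 4]; [:: 5; 8; 11; 9]]; [:: [:: 0; 1]; [:: 3; 5; 7;
   6]; [:: 4; 9; 12; 8]]; [:: [:: 0; 5; 1; 3]; [:: 4; 7]; [:: 6; 8; 12; 9]]; [:: [:: 0; 2; 1; 5];
   [:: 4; 6]; [:: 7; 9; 13; 8]]; [:: [:: 0; 4]; [:: 2; 6; 7; 5]; [:: 8; 13; 9; 11]]].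
Definition T1111 : seq (seq (seq nat)) :=
  [:: [:: [:: 1; 4]; [:: 2; 3]; [:: 5; 6]; [:: 7; 8]]; [:: [:: 1; 2]; [:: 3; 5]; [:: 4; 8]; [:: 6;
   7]]; [:: [:: 0; 5]; [:: 2; 6]; [:: 3; 7]; [:: 4; 9]]; [:: [:: 2; 7]; [:: 3; 4]; [:: 5; 9]; [:: 6;
   8]]; [:: [:: 2; 4]; [:: 3; 6]; [:: 5; 8]; [:: 7; 9]]; [:: [:: 0; 3]; [:: 1; 5]; [:: 4; 6]; [:: 7;
   10]]; [:: [:: 0; 4]; [:: 1; 3]; [:: 5; 7]; [:: 6; 10]]; [:: [:: 0; 1]; [:: 2; 5]; [:: 4; 7]; [::
   6; 11]]; [:: [:: 0; 2]; [:: 4; 5]; [:: 6; 9]; [:: 7; 11]]].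
Definition T11111 : seq (seq (seq nat)) :=
  [:: [:: [:: 1; 5]; [:: 2; 3]; [:: 4; 6]; [:: 7; 9]; [:: 8; 10]]; [:: [:: 1; 2]; [:: 3; 6]; [:: 4;
   5]; [:: 7; 10]; [:: 8; 9]]; [:: [:: 0; 3]; [:: 2; 6]; [:: 4; 9]; [:: 5; 8]; [:: 7; 11]]; [:: [::
   2; 7]; [:: 3; 4]; [:: 5; 6]; [:: 8; 11]; [:: 9; 10]]; [:: [:: 2; 4]; [:: 3; 5]; [:: 6; 10]; [::
   7; 8]; [:: 9; 11]]; [:: [:: 0; 5]; [:: 1; 4]; [:: 3; 7]; [:: 6; 9]; [:: 8; 12]]; [:: [:: 0; 4];
   [:: 1; 3]; [:: 5; 7]; [:: 6; 8]; [:: 9; 12]]; [:: [:: 0; 1]; [:: 2; 5]; [:: 4; 8]; [:: 6; 7]; [::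
   9; 13]]; [:: [:: 0; 2]; [:: 4; 7]; [:: 5; 9]; [:: 6; 11]; [:: 8; 13]]].
Definition T1112 : seq (seq (seq nat)) :=
  [:: [:: [:: 1; 4; 2; 5]; [:: 3; 6]; [:: 7; 10]; [:: 8; 9]]; [:: [:: 1; 3]; [:: 2; 6; 9; 7]; [:: 4;
   5]; [:: 8; 10]]; [:: [:: 0; 4]; [:: 2; 3; 5; 6]; [:: 7; 8]; [:: 9; 11]]; [:: [:: 2; 7; 4; 3]; [::
   5; 9]; [:: 6; 10]; [:: 8; 11]]; [:: [:: 2; 4; 8; 5]; [:: 3; 7]; [:: 6; 11]; [:: 9; 10]]; [:: [::
   0; 3; 4; 1]; [:: 5; 7]; [:: 6; 8]; [:: 9; 12]]; [:: [:: 0; 1; 5; 3]; [:: 4; 9]; [:: 6; 7]; [:: 8;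
   12]]; [:: [:: 0; 5]; [:: 1; 2]; [:: 4; 7; 9; 6]; [:: 8; 13]]; [:: [:: 0; 2]; [:: 4; 6; 5; 8]; [::
   7; 11]; [:: 9; 13]]].
Definition T14 : seq (seq (seq nat)) :=
  [:: [:: [:: 1; 3; 5; 2; 6; 10; 7; 4]; [:: 8; 9]]; [:: [:: 1; 2]; [:: 3; 4; 8; 10; 6; 7; 9; 5]];
   [:: [:: 0; 3; 6; 4; 5; 9; 7; 2]; [:: 8; 11]]; [:: [:: 2; 3; 7; 10; 8; 6; 5; 4]; [:: 9; 11]]; [::
   [:: 2; 5; 7; 11; 6; 8; 4; 3]; [:: 9; 10]]; [:: [:: 0; 1; 5; 6; 9; 4; 7; 3]; [:: 8; 12]]; [:: [::
   0; 5; 8; 7; 6; 3; 1; 4]; [:: 9; 12]]; [:: [:: 0; 4; 9; 6; 2; 7; 5; 1]; [:: 8; 13]]; [:: [:: 0; 2;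
   4; 6; 11; 7; 8; 5]; [:: 9; 13]]].
Definition T15 : seq (seq (seq nat)) :=
  [:: [:: [:: 8; 4; 1; 2; 5; 6; 3; 7; 9; 12]; [:: 10; 11]]; [:: [:: 11; 9; 6; 4; 5; 2; 7; 10; 8;
   12]; [:: 1; 3]]; [:: [:: 8; 5; 9; 10; 7; 4; 3; 6; 11; 13]; [:: 0; 2]]; [:: [:: 11; 6; 10; 12; 9;
   5; 4; 7; 8; 13]; [:: 2; 3]]; [:: [:: 10; 13; 9; 4; 2; 6; 8; 7; 11; 12]; [:: 3; 5]]; [:: [:: 11;
   7; 5; 1; 4; 6; 9; 8; 10; 14]; [:: 0; 3]]; [:: [:: 10; 6; 5; 7; 3; 4; 8; 9; 11; 14]; [:: 0; 1]];
   [:: [:: 10; 9; 7; 6; 2; 1; 5; 8; 11; 15]; [:: 0; 4]]; [:: [:: 10; 15; 11; 8; 6; 7; 2; 4; 9; 13];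
   [:: 0; 5]]].
Definition T23 : seq (seq (seq nat)) :=
  [:: [:: [:: 1; 3; 7; 10; 6; 2]; [:: 4; 9; 8; 5]]; [:: [:: 1; 5; 6; 3]; [:: 2; 7; 9; 10; 8; 4]];
   [:: [:: 0; 2; 3; 6; 4; 5]; [:: 7; 8; 11; 9]]; [:: [:: 2; 4; 8; 9; 5; 3]; [:: 6; 10; 7; 11]]; [::
   [:: 2; 6; 11; 7]; [:: 3; 5; 8; 10; 9; 4]]; [:: [:: 0; 3; 4; 1]; [:: 5; 9; 12; 8; 7; 6]]; [:: [::
   0; 5; 1; 4; 7; 3]; [:: 6; 8; 12; 9]]; [:: [:: 0; 1; 2; 5; 7; 4]; [:: 6; 9; 13; 8]]; [:: [:: 0; 4;
   6; 7; 5; 2]; [:: 8; 13; 9; 11]]].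
Definition T25 : seq (seq (seq nat)) :=
  [:: [:: [:: 10; 9; 4; 6; 8; 7; 11; 12; 13; 14]; [:: 1; 5; 3; 2]]; [:: [:: 13; 11; 7; 5; 8; 4; 9;
   10; 12; 14]; [:: 1; 2; 6; 3]]; [:: [:: 10; 7; 3; 6; 9; 8; 13; 12; 11; 15]; [:: 0; 2; 5; 4]]; [::
   [:: 13; 10; 14; 11; 8; 6; 7; 9; 12; 15]; [:: 2; 4; 3; 5]]; [:: [:: 12; 8; 9; 5; 6; 10; 13; 15;
   11; 14]; [:: 2; 3; 7; 4]]; [:: [:: 13; 9; 11; 6; 5; 7; 10; 8; 12; 16]; [:: 0; 3; 4; 1]]; [:: [::
   12; 9; 7; 6; 4; 8; 10; 11; 13; 16]; [:: 0; 5; 1; 3]]; [:: [:: 12; 10; 6; 2; 7; 8; 11; 9; 13; 17];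
   [:: 0; 1; 4; 5]]; [:: [:: 12; 17; 13; 8; 5; 9; 6; 11; 10; 15]; [:: 0; 4; 7; 2]]].
Definition T26 : seq (seq (seq nat)) :=
  [:: [:: [:: 11; 14; 16; 12]; [:: 4; 3; 6; 7; 2; 1; 5; 8; 13; 15; 10; 9]]; [:: [:: 13; 16; 15; 14];
   [:: 6; 5; 3; 1; 2; 7; 4; 8; 12; 9; 10; 11]]; [:: [:: 12; 14; 17; 15]; [:: 9; 5; 4; 2; 0; 3; 7; 6;
   8; 10; 13; 11]]; [:: [:: 12; 16; 13; 17]; [:: 8; 7; 3; 2; 4; 5; 9; 6; 10; 14; 15; 11]]; [:: [::
   11; 15; 16; 14]; [:: 8; 5; 6; 2; 3; 4; 9; 7; 10; 12; 17; 13]]; [:: [:: 12; 15; 18; 14]; [:: 10;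
   6; 3; 5; 0; 1; 4; 7; 8; 9; 11; 13]]; [:: [:: 13; 14; 18; 15]; [:: 10; 7; 5; 1; 3; 0; 4; 6; 9; 12;
   8; 11]]; [:: [:: 10; 15; 19; 14]; [:: 6; 4; 1; 0; 2; 5; 7; 11; 12; 13; 9; 8]]; [:: [:: 14; 19;
   15; 17]; [:: 4; 0; 5; 2; 6; 11; 7; 9; 13; 12; 10; 8]]].
Definition T113 : seq (seq (seq nat)) :=
  [:: [:: [:: 1; 2]; [:: 3; 4; 8; 5; 9; 7]; [:: 6; 10]]; [:: [:: 1; 3]; [:: 2; 5; 8; 9; 4; 6]; [::
   7; 10]]; [:: [:: 0; 2]; [:: 3; 5]; [:: 4; 9; 8; 7; 11; 6]]; [:: [:: 2; 3]; [:: 4; 5; 6; 8; 11;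
   7]; [:: 9; 10]]; [:: [:: 2; 4; 3; 6; 7; 5]; [:: 8; 10]; [:: 9; 11]]; [:: [:: 0; 4]; [:: 1; 5];
   [:: 3; 7; 8; 12; 9; 6]]; [:: [:: 0; 3]; [:: 1; 4]; [:: 5; 7; 9; 12; 8; 6]]; [:: [:: 0; 1]; [:: 2;
   6; 9; 5; 4; 7]; [:: 8; 13]]; [:: [:: 0; 5]; [:: 2; 7; 6; 11; 8; 4]; [:: 9; 13]]].
Definition T12 : seq (seq (seq nat)) :=
  [:: [:: [:: 1; 2; 4; 5]; [:: 3; 6]]; [:: [:: 1; 3; 5; 4]; [:: 2; 6]]; [:: [:: 0; 3; 2; 5]; [:: 4;
   7]]; [:: [:: 2; 3; 7; 5]; [:: 4; 6]]; [:: [:: 2; 7; 3; 4]; [:: 5; 6]]; [:: [:: 0; 4; 3; 1]; [::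
   5; 8]]; [:: [:: 0; 1; 5; 3]; [:: 4; 8]]; [:: [:: 0; 2; 1; 4]; [:: 5; 9]]; [:: [:: 0; 5; 7; 2];
   [:: 4; 9]]].

Lemma tiled_22 : tiled [:: 2; 2]. Proof. by eexists; apply: (@tilingP _ T22); vm_compute. Qed.
Lemma tiled_12 : tiled [:: 1; 2]. Proof. by eexists; apply: (@tilingP _ T12); vm_compute. Qed.
Lemma tiled_112 : tiled [:: 1; 1; 2]. Proof. by eexists; apply: (@tilingP _ T112); vm_compute. Qed.
Lemma tiled_122 : tiled [:: 1; 2; 2]. Proof. by eexists; apply: (@tilingP _ T122); vm_compute. Qed.
Lemma tiled_1111 : tiled [:: 1; 1; 1; 1].
Proof. by eexists; apply: (@tilingP _ T1111); vm_compute. Qed.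
Lemma tiled_11111 : tiled [:: 1; 1; 1; 1; 1].
Proof. by eexists; apply: (@tilingP _ T11111); vm_compute. Qed.
Lemma tiled_1112 : tiled [:: 1; 1; 1; 2].
Proof. by eexists; apply: (@tilingP _ T1112); vm_compute. Qed.
Lemma tiled_14 : tiled [:: 4; 1]. Proof. by eexists; apply: (@tilingP _ T14); vm_compute. Qed.
Lemma tiled_15 : tiled [:: 5; 1]. Proof. by eexists; apply: (@tilingP _ T15); vm_compute. Qed.
Lemma tiled_23 : tiled [:: 3; 2]. Proof. by eexists; apply: (@tilingP _ T23); vm_compute. Qed.
Lemma tiled_25 : tiled [:: 5; 2]. Proof. by eexists; apply: (@tilingP _ T25); vm_compute. Qed.
Lemma tiled_26 : tiled [:: 6; 2]. Proof. by eexists; apply: (@tilingP _ T26); vm_compute. Qed.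
Lemma tiled_113 : tiled [:: 3; 1; 1]. Proof. by eexists; apply: (@tilingP _ T113); vm_compute. Qed.

Lemma opened_13 : opened [:: 1] 3. Proof. by apply: (@openP _ _ D13 Q13); vm_compute. Qed.
Lemma opened_111 : opened [:: 1; 1] 1. Proof. by apply: (@openP _ _ D111 Q111); vm_compute. Qed.
Lemma opened_24 : opened [:: 2] 4. Proof. by apply: (@openP _ _ D24 Q24); vm_compute. Qed.

Lemma single_M3 : single M3 3. Proof. by vm_compute. Qed.
Lemma single_R4 : single R4 4. Proof. by vm_compute. Qed.
Lemma single_R5 : single R5 5. Proof. by vm_compute. Qed.

(** [M3cut] locates the left port arc in each cycle of [M3]. *)
Definition M3l := [seq take p.1 p.2 | p <- zip M3cut M3].
Definition M3r := [seq drop p.1 p.2 | p <- zip M3cut M3].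

(** This is [M3] itself, rotated so that its left port arc becomes the closing one. *)
Lemma opened_3 : opened [::] 3.
Proof.
apply: (@openP _ _ [::] [seq nth [::] M3r j ++ nth [::] M3l j | j <- factor_ids]).
by vm_compute.
Qed.

Lemma opened_add3 ext q : opened ext q -> opened ext (q + 3).
Proof. by move=> h; apply: (@open_step _ _ M3l M3r) => //; vm_compute. Qed.

(** Copies of [M3] are attached until 3, 4 or 5 remains, and the closing tile supplies the
    remainder: one table per residue modulo 3. *)
Lemma opened_tiled_ge3 ext q r : opened ext q -> 3 <= r -> tiled (q + r :: ext).
Proof.
elim/ltn_ind: r q => r IH q op r3.
have [r6|] := leqP 6 r.
  have -> : q + r = (q + 3) + (r - 3) by lia.
  by apply: IH; [lia | apply: opened_add3 | lia].
case: r r3 {IH} => [|[|[|[|[|[|r]]]]]] // _ _.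
- exact: open_close op _ single_M3.
- exact: open_close op _ single_R4.
- exact: open_close op _ single_R5.
Qed.

Lemma tiled_ge3 c : 3 <= c -> tiled [:: c].
Proof.
move=> c3; have [c6|] := leqP 6 c.
  by rewrite (_ : c = 3 + (c - 3)); [apply: (opened_tiled_ge3 opened_3) | ]; lia.
case: c c3 => [|[|[|[|[|[|c]]]]]] // _ _.
- exact: single_tiled single_M3.
- exact: single_tiled single_R4.
- exact: single_tiled single_R5.
Qed.

Lemma tiled_ge3_1 c : 3 <= c -> tiled [:: c; 1].
Proof.
move=> c3; have [c6|] := leqP 6 c.
  by rewrite (_ : c = 3 + (c - 3)); [apply: (opened_tiled_ge3 opened_13) | ]; lia.
case: c c3 => [|[|[|[|[|[|c]]]]]] // _ _.
- exact: opened_tiled opened_13.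
- exact: tiled_14.
- exact: tiled_15.
Qed.

Lemma tiled_ge3_11 c : 3 <= c -> tiled [:: c; 1; 1].
Proof.
move=> c3; have [c4|] := leqP 4 c.
  by rewrite (_ : c = 1 + (c - 1)); [apply: (opened_tiled_ge3 opened_111) | ]; lia.
case: c c3 => [|[|[|[|c]]]] // _ _; exact: tiled_113.
Qed.

Lemma tiled_ge3_2 c : 3 <= c -> tiled [:: c; 2].
Proof.
move=> c3; have [c7|] := leqP 7 c.
  by rewrite (_ : c = 4 + (c - 4)); [apply: (opened_tiled_ge3 opened_24) | ]; lia.
case: c c3 => [|[|[|[|[|[|[|c]]]]]]] // _ _.
- exact: tiled_23.
- exact: opened_tiled opened_24.
- exact: tiled_25.
- exact: tiled_26.
Qed.

Lemma tiled_nseq n c : tiled c -> tiled (flatten (nseq n c)).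
Proof. by move=> h; elim: n => [|n IH] /=; [apply: tiled_nil | apply: tiled_cat]. Qed.

Lemma tiled_big bs : all (leq 3) bs -> tiled bs.
Proof.
elim: bs => [|c bs IH] /=; first by move=> _; apply: tiled_nil.
by case/andP=> c3 /IH; rewrite -cat1s; apply/tiled_cat/tiled_ge3.
Qed.

Lemma perm_flatten_nseq (T : eqType) (x : T) k n : flatten (nseq k (nseq n x)) = nseq (k * n) x.
Proof. by elim: k => //= k ->; rewrite mulSn nseqD. Qed.

Lemma tiled_ones k : tiled (nseq (k * 3) 1).
Proof.
rewrite -perm_flatten_nseq; apply: tiled_nseq; exact: opened_tiled opened_111.
Qed.

Lemma tiled_twos k : tiled (nseq (k * 2) 2).
Proof. rewrite -perm_flatten_nseq; apply: tiled_nseq; exact: tiled_22. Qed.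

(** Parts of size at least 3 are tiled alone, ones in triples, twos in pairs. What is left over, at
    most two ones and one two, is either a tile by itself or joins a big part, a triple of ones or a
    pair of twos; the parity of the sum and the bound 5 ensure that such a partner exists. *)
Lemma tiled_all lam : all (leq 1) lam -> odd (sumn lam) -> 5 <= sumn lam -> tiled lam.
Proof.
move=> lam1.
have p : perm_eq (nseq (count_mem 1 lam) 1 ++ nseq (count_mem 2 lam) 2 ++
                  filter (leq 3) lam) lam.
  apply/permP => P; rewrite !count_cat !count_nseq.
  elim: lam lam1 => [|x s IH] /=; first by rewrite !muln0.
  case/andP=> x1 /IH {IH}; case: x x1 => [|[|[|x]]] //= _; lia_count.
rewrite -(perm_sumn p) !sumn_cat !sumn_nseq => lam_odd lam5.
apply: (tiled_perm p); move: (filter_all (leq 3) lam) lam_odd lam5.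
move: (filter _ _) (count_mem 1 lam) (count_mem 2 lam) => bs a b bs3 {p lam1 lam}.
rewrite {1 2 3}(divn_eq a 3) {1 2 3}(divn_eq b 2).
move: (a %/ 3) (a %% 3) (ltn_pmod a (isT : 0 < 3)) => a' ra ra3.
move: (b %/ 2) (b %% 2) (ltn_pmod b (isT : 0 < 2)) => b' rb rb2.
rewrite !nseqD -!catA => s_odd s5.
suff [ex [k1 [k2 [cs [h1 h2 h3]]]]] : exists ex k1 k2 cs, [/\ tiled ex, all (leq 3) cs &
    perm_eq (ex ++ nseq (k1 * 3) 1 ++ nseq (k2 * 2) 2 ++ cs)
            (nseq (a' * 3) 1 ++ nseq ra 1 ++ nseq (b' * 2) 2 ++ nseq rb 2 ++ bs)].
  apply: (tiled_perm h3); apply: tiled_cat h1 _.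
  apply: tiled_cat (tiled_ones _) _; apply: tiled_cat (tiled_twos _) _; exact: tiled_big.
have tiled_by ex k1 k2 cs : tiled ex -> all (leq 3) cs ->
    (forall P : pred nat, count P ex + P 1 * (k1 * 3) + P 2 * (k2 * 2) + count P cs =
       P 1 * (a' * 3) + P 1 * ra + P 2 * (b' * 2) + P 2 * rb + count P bs) ->
    exists ex k1 k2 cs, [/\ tiled ex, all (leq 3) cs &
    perm_eq (ex ++ nseq (k1 * 3) 1 ++ nseq (k2 * 2) 2 ++ cs)
            (nseq (a' * 3) 1 ++ nseq ra 1 ++ nseq (b' * 2) 2 ++ nseq rb 2 ++ bs)].
  move=> h1 h2 h3; exists ex, k1, k2, cs; split=> //; apply/permP => P.
  by have := h3 P; rewrite !count_cat !count_nseq; lia_count.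
case: ra ra3 s_odd s5 tiled_by => [|[|[|ra]]] //; case: rb rb2 => [|[|rb]] // _ _ s_odd s5 tiled_by.
- by apply: (tiled_by [::] a' b' bs) => // [|P]; [apply: tiled_nil | rewrite /=; lia_count].
- case: bs bs3 s_odd s5 tiled_by => [|c bs] /= bs3 s_odd s5 tiled_by.
    (* Without big parts and without ones the sum would be even, so there is a triple of ones to
       break up. *)
    apply: (tiled_by [:: 1; 1; 1; 2] a'.-1 b' [::] tiled_1112) => // P /=.
    case: a' s_odd {s5 tiled_by} => [|a'] h; last lia_count.
    by move: h; rewrite !muln0 /=; lia.
  case/andP: bs3 => c3 bs3.
  by apply: (tiled_by [:: c; 2] a' b' bs (tiled_ge3_2 c3)) => // P /=; lia_count.
- case: bs bs3 s_odd s5 tiled_by => [|c bs] /= bs3 s_odd s5 tiled_by.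
    case: b' s_odd s5 tiled_by => [|b'] h h5 tiled_by.
      (* Only ones are left; the bound 5 rules out a single one. *)
      apply: (tiled_by [:: 1; 1; 1; 1] a'.-1 0 [::] tiled_1111) => // P /=.
      case: a' h h5 {tiled_by} => [|a'] h h5; last lia_count.
      by move: h5; rewrite !muln0 /=; lia.
    by apply: (tiled_by [:: 1; 2; 2] a' b' [::] tiled_122) => // P /=; lia_count.
  case/andP: bs3 => c3 bs3.
  by apply: (tiled_by [:: c; 1] a' b' bs (tiled_ge3_1 c3)) => // P /=; lia_count.
- by apply: (tiled_by [:: 1; 2] a' b' bs tiled_12) => // P /=; lia_count.
- case: bs bs3 s_odd s5 tiled_by => [|c bs] /= bs3 s_odd s5 tiled_by.
    apply: (tiled_by [:: 1; 1; 1; 1; 1] a'.-1 b' [::] tiled_11111) => // P /=.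
    case: a' s_odd {s5 tiled_by} => [|a'] h; last lia_count.
    by move: h; rewrite !muln0 /=; lia.
  case/andP: bs3 => c3 bs3.
  by apply: (tiled_by [:: c; 1; 1] a' b' bs (tiled_ge3_11 c3)) => // P /=; lia_count.
- by apply: (tiled_by [:: 1; 1; 2] a' b' bs tiled_112) => // P /=; lia_count.
Qed.

(** * Closing up the strip modulo 2m *)

Definition bdiff m x y := (y + m - x) %% m.

Lemma half_mod x m : (x %% m.*2)./2 = x./2 %% m.
Proof. by rewrite -!divn2 -muln2 modn_divl. Qed.

Lemma bdiff_shift m p a b : 0 < m -> a <= m ->
  bdiff m ((p + a) %% m) ((p + b) %% m) = (b + m - a) %% m.
Proof.
move=> m0 am; rewrite /bdiff.
have h : (p + a) %% m < m by rewrite ltn_mod.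
apply/eqP; rewrite -(eqn_modDr ((p + a) %% m)) subnK; last by lia.
rewrite modnDmr modnDr modn_mod.
by rewrite (_ : b + m - a + (p + a) = p + b + m) ?modnDr //; lia.
Qed.

(** The position differences 0, 1, 2, -1, -2 of the rungs and of C_m(1,2); this is the invariant
    that keeps the nine factors disjoint from those over the Hamilton cycles. *)
Definition near m (e : nat * nat) :=
  bdiff m e.1./2 e.2./2 \in [:: 0; 1; 2; m.-1; m.-2].

Lemma strip_cell_inj : all (fun e => all (fun e' =>
  ((e.1 + e'.2 == e'.1 + e.2) && (odd e.1 == odd e'.1)) ==> (e == e')) strip_cell) strip_cell.
Proof. by vm_compute. Qed.

Lemma strip_cell_le : all (fun e => (e.1 <= 5) && (e.2 <= 5)) strip_cell.
Proof. by vm_compute. Qed.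

Lemma modn_double_odd x m : odd (x %% m.*2) = odd x.
Proof. by rewrite {2}(divn_eq x m.*2) oddD -muln2 mulnA oddM andbF. Qed.

(** Within a cell, the parity of the tail and the difference of the ends identify an arc
    ([strip_cell_inj]). Both can be recovered after reduction modulo the even number [m.*2], and
    then the position is determined as well. *)
Lemma strip_mod m : 5 <= m -> uniq [seq (e.1 %% m.*2, e.2 %% m.*2) | e <- strip m].
Proof.
move=> m5.
have -> : [seq (e.1 %% m.*2, e.2 %% m.*2) | e <- strip m] =
    [seq ((p.*2 + e.1) %% m.*2, (p.*2 + e.2) %% m.*2) | p <- iota 0 m, e <- strip_cell].
  rewrite /strip map_flatten -map_comp; apply: (congr1 flatten).
  by apply: eq_map => p; rewrite /comp /shift_arcs -map_comp.
apply: allpairs_uniq; [exact: iota_uniq | by vm_compute|].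
move=> x y /allpairsP[[p1 e1] [pm ein ->]] /allpairsP[[p2 e2] [p'm e'in ->]] /= [h1 h2].
rewrite !mem_iota /= in pm p'm; rewrite [_.2]/= in ein; rewrite [_.2]/= in e'in.
have o1 : odd e1.1 = odd e2.1.
  by have := congr1 odd h1; rewrite !modn_double_odd !oddD !odd_double.
have o2 : odd e1.2 = odd e2.2.
  by have := congr1 odd h2; rewrite !modn_double_odd !oddD !odd_double.
have /andP[le1 le2] := allP strip_cell_le _ ein.
have /andP[le3 le4] := allP strip_cell_le _ e'in.
have h3 : e1.1 + e2.2 = e2.1 + e1.2 %[mod m.*2].
  apply/eqP; rewrite -(eqn_modDl (p1.*2 + p2.*2)).
  have -> : p1.*2 + p2.*2 + (e1.1 + e2.2) = (p1.*2 + e1.1) + (p2.*2 + e2.2) by lia.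
  have -> : p1.*2 + p2.*2 + (e2.1 + e1.2) = (p2.*2 + e2.1) + (p1.*2 + e1.2) by lia.
  by rewrite -modnDm h1 -h2 modnDm.
case: e1 e2 ein e'in h1 h2 h3 o1 o2 le1 le2 le3 le4 => [x1 y1] [x2 y2] ein e'in /=.
move=> h1 h2 h3 o1 o2 le1 le2 le3 le4.
have [ex ey] : x1 = x2 /\ y1 = y2.
  suff /eqP[-> ->] : (x1, y1) == (x2, y2) by [].
  apply: (implyP (allP (allP strip_cell_inj _ ein) _ e'in)).
  rewrite o1 eqxx andbT; apply/eqP => /=.
  (* Both sums are at most 10, so being congruent they are equal unless [m = 5] and they are 0 and
     10; then the tails would be 0 and 5, of different parity. *)
  have [lt|ge] := ltnP (x1 + y2) m.*2; have [lt'|ge'] := ltnP (x2 + y1) m.*2.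
  - by move: h3; rewrite !modn_small.
  - have [e21 e12] : x2 = 5 /\ y1 = 5 by clear - m5 le2 le3 ge'; lia.
    have E : x2 + y1 = m.*2 by clear - m5 le2 le3 ge'; lia.
    move: h3 o1; rewrite E modnn modn_small // e21.
    by case: (x1).
  - have [e11 e22] : x1 = 5 /\ y2 = 5 by clear - m5 le1 le4 ge; lia.
    have E : x1 + y2 = m.*2 by clear - m5 le1 le4 ge; lia.
    move: h3 o1; rewrite E modnn modn_small // e11.
    by case: (x2).
  - by clear - m5 le1 le2 le3 le4 ge ge'; lia.
rewrite ex ey in h1 *; congr (_, _); apply: double_inj; apply/eqP.
move/eqP: h1; rewrite eqn_modDr !modn_small //; clear - pm p'm; lia.
Qed.

Lemma strip_near m e : 5 <= m -> e \in strip m -> near m (e.1 %% m.*2, e.2 %% m.*2).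
Proof.
move=> m5 /flatten_mapP[p _ /mapP[e1 ein ->]] /=.
have m0 : 0 < m by lia.
rewrite /near /= !half_mod !halfD !odd_double /= !add0n !doubleK.
have /andP[le1 le2] := allP strip_cell_le _ ein.
rewrite bdiff_shift //; last by lia.
have [a2 b2] : e1.1./2 <= 2 /\ e1.2./2 <= 2 by split; [apply: half_leq le1 | apply: half_leq le2].
move: (e1.1./2) (e1.2./2) a2 b2 => a b a2 b2.
have -> : (b + m - a) %% m = if a <= b then b - a else b + m - a.
  case: ifP => ab; last by rewrite modn_small //; lia.
  by rewrite -addnBAC ?modnDr ?modn_small //; lia.
by rewrite !inE; case: ifP; lia.
Qed.

(** Modulo [m.*2] the interface covered beyond the end coincides with the one omitted at the
    beginning, so the two cancel and each factor becomes spanning. *)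
Lemma strip_factors m lam : 5 <= m -> sumn lam = m -> tiled lam ->
  exists Fs : seq (seq (seq nat)), [/\ size Fs = 9,
    {in Fs, forall cs, perm_eq (flatten cs) (iota 0 m.*2) /\
                       perm_eq (map size cs) (map double lam)},
    uniq (flatten (map (@factor_arcs nat) Fs)) &
    {in flatten (map (@factor_arcs nat) Fs), forall e, near m e}].
Proof.
move=> m5 Em [c [c1 c2 c3]]; rewrite Em in c1 c2.
pose f x := x %% m.*2; pose ff (e : nat * nat) := (f e.1, f e.2).
exists [seq map (map f) (c j) | j <- factor_ids]; split=> //.
- move=> cs /mapP[j jin ->]; split; last first.
    rewrite -map_comp (eq_map (g := size)) ?c3 // => s /=; exact: size_map.
  have : perm_eq (map f (interface j ++ flatten (c j)))
                 (map f (iota 0 m.*2 ++ map (addn m.*2) (interface j))).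
    exact/perm_map/c1.
  rewrite !map_cat -!map_comp -map_flatten.
  have -> : map (f \o addn m.*2) (interface j) = map f (interface j).
    by apply: eq_map => x; rewrite /f /= modnDl.
  have -> : map f (iota 0 m.*2) = iota 0 m.*2.
    rewrite -[RHS]map_id; apply/eq_in_map => x; rewrite mem_iota /= => xm.
    by rewrite /f modn_small.
  by rewrite perm_catC perm_cat2r.
- have -> : flatten (map (@factor_arcs nat) [seq map (map f) (c j) | j <- factor_ids]) =
            map ff (flatten [seq factor_arcs (c j) | j <- factor_ids]).
    rewrite map_flatten -!map_comp; congr flatten; apply: eq_map => j.
    by rewrite /= factor_arcs_map.
  by rewrite (perm_uniq (perm_map ff c2)) strip_mod.
- move=> e /flatten_mapP[cs /mapP[j jin ->]]; rewrite factor_arcs_map => /mapP[e' e'in ->].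
  apply: strip_near => //; rewrite -(perm_mem c2).
  by apply/flatten_mapP; exists j.
Qed.

(** * Four factors over a Hamilton cycle *)

(* Three balanced vectors in {0,1}^4 such that any two of them take the four
   pairs of values on the four factors. *)
Definition bits (k j : nat) : bool :=
  match k with 0 => odd j | 1 => 1 < j | _ => odd j (+) (1 < j) end.

Lemma bits_inj k k' j j' : k < 3 -> k' < 3 -> k != k' -> j < 4 -> j' < 4 ->
  bits k j = bits k j' -> bits k' j = bits k' j' -> j = j'.
Proof.
by case: k => [|[|[|k]]] //; case: k' => [|[|[|k']]] // _ _ _;
  case: j => [|[|[|[|j]]]] //; case: j' => [|[|[|[|j']]]].
Qed.

(** A proper colouring of the cycle of positions: two colours alternate, and the third one on the
    last position copes with odd [m]. *)
Definition colour m i := if i == m.-1 then 2 else odd i : nat.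

Lemma colour_neq m i : 3 <= m -> i < m -> colour m i != colour m (i.+1 %% m).
Proof.
move=> m3 im; rewrite /colour.
have [E|ni] := eqVneq i m.-1.
  rewrite E prednK; last lia.
  by rewrite modnn (_ : 0 == m.-1 = false) //; lia.
rewrite modn_small; last lia.
by case: ifP => _; rewrite /=; case: (odd i).
Qed.

Lemma cycle_arcs_split (T : Type) (x y : T) s t :
  cycle_arcs (x :: s ++ y :: t) = path_arcs (x :: rcons s y) ++ path_arcs (y :: rcons t x).
Proof.
have E a b u : path_arcs (a :: rcons u b) = rcons (path_arcs (a :: u)) (last a u, b :> T).
  by rewrite -cats1 -cat_cons path_arcs_cat cats1.
by rewrite cycle_arcs_cons -cat_cons path_arcs_cat last_cat !E cat_rcons rcons_cat rcons_cons.
Qed.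

Section Pack.
Variables (m : nat) (C : seq nat).
Hypotheses (m3 : 3 <= m) (pC : perm_eq C (iota 0 m)).

Definition base_pt i := nth 0 C (i %% m).
Definition layer j i := bits (colour m (i %% m)) j.
Definition vtx i (b : bool) := (base_pt i).*2 + b.
Definition fw p j i := vtx i (layer j i (+) (i == p)).
Definition bw q j i := vtx i (~~ layer j i (+) (i == q)).
(* The cycle leaves p in the complementary layer, runs forward to p + k + 1 in the
   prescribed layers and returns in the complementary ones; the next cycle starts at the unused
   copy of p + k + 1. *)
Definition pack_cycle j p k :=
  map (fw p j) (iota p k.+2) ++ rev (map (bw (p + k.+1) j) (iota p.+1 k)).

Fixpoint pack_factor j p lam :=
  if lam is l :: lam' then pack_cycle j p l.-1 :: pack_factor j (p + l) lam' else [::].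
Fixpoint cuts p lam := if lam is l :: lam' then p :: cuts (p + l) lam' else [:: p].

Lemma base_pt_inj i i' : i < m -> i' < m -> base_pt i = base_pt i' -> i = i'.
Proof.
move=> im i'm /eqP; rewrite /base_pt !modn_small // nth_uniq; first by move/eqP.
- by rewrite (perm_size pC) size_iota.
- by rewrite (perm_size pC) size_iota.
- by rewrite (perm_uniq pC) iota_uniq.
Qed.

Lemma vtx_inj i i' b b' : i < m -> i' < m -> vtx i b = vtx i' b' -> i = i' /\ b = b'.
Proof.
move=> im i'm E; have Eb : b = b'.
  by have := congr1 odd E; rewrite /vtx !oddD !odd_double; case: b b' {E} => [] [].
split=> //; apply: base_pt_inj => //; move: E; rewrite /vtx Eb; lia.
Qed.

Lemma size_pack_factor j p lam : all (leq 1) lam -> map size (pack_factor j p lam) = map double lam.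
Proof.
elim: lam p => //= l lam IH p /andP[l1 /IH->]; congr cons.
by rewrite /pack_cycle size_cat size_rev !size_map !size_iota; lia.
Qed.

Lemma vtx_modm i b : vtx (i %% m) b = vtx i b.
Proof. by rewrite /vtx /base_pt modn_mod. Qed.

Lemma layer_modm j i : layer j (i %% m) = layer j i. Proof. by rewrite /layer modn_mod. Qed.

Definition uu j i := vtx i (layer j i).
Definition ww j i := vtx i (~~ layer j i).

(** The prescribed copy of [p] belongs to the preceding cycle and the complementary copy of
    [p + k.+1] to the next one; hence both ranges abut when cycles are strung together. *)
Lemma perm_pack_cycle j p k : perm_eq (pack_cycle j p k) (map (ww j) (iota p k.+1) ++ map (uu j) (iota p.+1 k.+1)).
Proof.
have iS (f : nat -> nat) n : map f (iota p n.+1) = f p :: map f (iota p.+1 n) by [].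
rewrite /pack_cycle (iS (fw p j)) (iS (ww j)) (_ : fw p j p = ww j p); last by rewrite /fw eqxx addbT.
have -> : map (fw p j) (iota p.+1 k.+1) = map (uu j) (iota p.+1 k.+1).
  apply/eq_in_map => i; rewrite mem_iota /fw => h.
  by rewrite (_ : i == p = false) ?addbF //; lia.
have -> : map (bw (p + k.+1) j) (iota p.+1 k) = map (ww j) (iota p.+1 k).
  apply/eq_in_map => i; rewrite mem_iota /bw => h.
  by rewrite (_ : i == _ = false) ?addbF //; lia.
rewrite -(cat1s _ (map (uu j) _)) -(cat1s _ (map (ww j) _)).
by apply/permP => P; rewrite !count_cat count_rev; lia_count.
Qed.

Lemma perm_pack_factor j p lam : all (leq 1) lam ->
  perm_eq (flatten (pack_factor j p lam))
          (map (ww j) (iota p (sumn lam)) ++ map (uu j) (iota p.+1 (sumn lam))).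
Proof.
elim: lam p => //= l lam IH p /andP[l1 {}/IH IH].
apply: (perm_trans (perm_cat (perm_pack_cycle _ _ _) (IH _))).
rewrite prednK // !iotaD !map_cat addSn; apply/permP => P; rewrite !count_cat; lia.
Qed.

Lemma pack_factor_flatten j lam : all (leq 1) lam -> sumn lam = m ->
  perm_eq (flatten (pack_factor j 0 lam)) (iota 0 m.*2).
Proof.
move=> l1 Em; apply: (perm_trans (perm_pack_factor j 0 l1)); rewrite Em.
have m0 : 0 < m by lia.
have E : perm_eq (map (uu j) (iota 1 m)) (map (uu j) (iota 0 m)).
  have [k Ek] : exists k, m = k.+1 by exists m.-1; lia.
  have iS n : iota 1 n.+1 = rcons (iota 1 n) n.+1 by rewrite -cats1 -[in LHS](addn1 n) iotaD.
  rewrite Ek iS map_rcons perm_rcons -Ek (_ : iota 0 m = 0 :: iota 1 k); last by rewrite Ek.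
  by rewrite map_cons (_ : uu j m = uu j 0) // /uu -(vtx_modm m) -(layer_modm j m) modnn.
apply: (perm_trans (perm_cat (perm_refl _) E)).
apply: uniq_perm; rewrite ?iota_uniq //.
  rewrite cat_uniq !map_inj_in_uniq ?iota_uniq //=; last 2 first.
  - move=> i i'; rewrite !mem_iota /= => im i'm E'.
    by have [] := vtx_inj im i'm E'.
  - move=> i i'; rewrite !mem_iota /= => im i'm E'.
    by have [] := vtx_inj im i'm E'.
  rewrite andbT; apply/hasPn => _ /mapP[i + ->]; rewrite mem_iota /= => im.
  apply/mapP => -[i']; rewrite mem_iota /= => i'm E'.
  by have [ii] := vtx_inj im i'm E'; rewrite ii; case: layer.
move=> x; rewrite mem_cat mem_iota /=.
have cvm i : base_pt i < m.
  have : base_pt i \in C by rewrite mem_nth // (perm_size pC) size_iota ltn_mod.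
  by rewrite (perm_mem pC) mem_iota.
apply/orP/idP => [|xm].
  by case=> /mapP[i _ ->]; rewrite /uu /ww /vtx; have := cvm i; case: layer => /=; lia.
have : x./2 \in C by rewrite (perm_mem pC) mem_iota /=; lia.
case/(nthP 0) => i; rewrite (perm_size pC) size_iota => im Ei.
have Ex : x = vtx i (odd x).
  by rewrite /vtx /base_pt modn_small // Ei addnC odd_double_half.
have [Eb|Eb] := eqVneq (odd x) (layer j i).
  by right; apply/mapP; exists i; rewrite ?mem_iota // Ex Eb.
left; apply/mapP; exists i; rewrite ?mem_iota // {1}Ex /ww.
by case: (odd x) (layer j i) Eb => [] [].
Qed.

Lemma mem_path_arcs_map (f : nat -> nat) a n e :
  e \in path_arcs (map f (iota a n)) -> exists2 i, a <= i /\ i.+1 < a + n & e = (f i, f i.+1).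
Proof.
elim: n a => [|[|n] IH] a //=; rewrite in_cons => /orP[/eqP->|].
  by exists a => //; lia.
by case/IH => i h ->; exists i => //; lia.
Qed.

Definition cut B i := i %% m \in (B : seq nat).
(** The flip at a cut depends on the cycle lengths but not on the factor [j]. It therefore cancels
    when arcs of two factors are compared. *)
Definition pack_arc B j i e :=
  e = (vtx i (layer j i (+) cut B i), vtx i.+1 (layer j i.+1)) \/
  e = (vtx i.+1 (~~ layer j i.+1 (+) cut B i.+1), vtx i (~~ layer j i)).

(** The cycle is made of a forward and a backward path over the same positions with common ends, so
    it passes each base edge in its range once in either direction. *)
Lemma mem_pack_cycle B j p k e :
  cut B p -> cut B (p + k.+1) -> (forall i, p < i < p + k.+1 -> ~~ cut B i) ->
  e \in cycle_arcs (pack_cycle j p k) -> exists2 i, p <= i < p + k.+1 & pack_arc B j i e.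
Proof.
move=> cp cq ci.
have iS n : iota p n.+1 = rcons (iota p n) (p + n) by rewrite -cats1 -[in LHS](addn1 n) iotaD.
have x_g : fw p j p = bw (p + k.+1) j p.
  by rewrite /fw /bw eqxx (_ : p == _ = false) ?addbT ?addbF //; lia.
have y_g : fw p j (p + k.+1) = bw (p + k.+1) j (p + k.+1).
  by rewrite /fw /bw eqxx (_ : _ == p = false) ?addbT ?addbF ?negbK //; lia.
have Eb : pack_cycle j p k = fw p j p :: map (fw p j) (iota p.+1 k) ++
                      fw p j (p + k.+1) :: rev (map (bw (p + k.+1) j) (iota p.+1 k)).
  by rewrite /pack_cycle iS map_rcons cat_rcons.
have E1 : fw p j p :: rcons (map (fw p j) (iota p.+1 k)) (fw p j (p + k.+1)) =
          map (fw p j) (iota p k.+2) by rewrite iS map_rcons.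
have E2 : fw p j (p + k.+1) :: rcons (rev (map (bw (p + k.+1) j) (iota p.+1 k))) (fw p j p) =
          rev (map (bw (p + k.+1) j) (iota p k.+2)).
  by rewrite iS map_rcons rev_rcons -y_g x_g -rev_cons.
rewrite Eb cycle_arcs_split E1 E2 path_arcs_rev mem_cat mem_rev => /orP[].
  case/mem_path_arcs_map => i [pi ik] ->; exists i; first by lia.
  left; rewrite /fw; congr (vtx _ (_ (+) _), vtx _ _).
    have [->|ip] := eqVneq i p; first by rewrite cp.
    by apply/esym/negbTE/ci; lia.
  by rewrite (_ : _ == p = false) ?addbF //; lia.
case/mapP=> e' /mem_path_arcs_map[i [pi ik] ->] ->; exists i; first by lia.
right; rewrite /swap /bw /=; congr (vtx _ (_ (+) _), vtx _ _); last first.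
  by rewrite (_ : i == _ = false) ?addbF //; lia.
have [->|ip] := eqVneq i.+1 (p + k.+1); first by rewrite cq.
by apply/esym/negbTE/ci; lia.
Qed.

Lemma cuts_ge p lam x : x \in cuts p lam -> p <= x.
Proof.
elim: lam p => [|l lam IH] p /=; first by rewrite inE => /eqP->.
by rewrite in_cons => /orP[/eqP->|/IH] //; lia.
Qed.

Lemma mem_cuts_head p lam : p \in cuts p lam.
Proof. by case: lam => [|l lam] /=; rewrite mem_head. Qed.

Lemma mem_pack_factor B j p lam e :
  all (leq 1) lam -> (forall i, p <= i <= p + sumn lam -> cut B i = (i \in cuts p lam)) ->
  e \in factor_arcs (pack_factor j p lam) -> exists2 i, p <= i < p + sumn lam & pack_arc B j i e.
Proof.
elim: lam p => // l lam IH p /andP[l1 lam1] cutB.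
have -> : factor_arcs (pack_factor j p (l :: lam)) = cycle_arcs (pack_cycle j p l.-1) ++ factor_arcs (pack_factor j (p + l) lam) by [].
rewrite /= in cutB; rewrite mem_cat [sumn _]/= => /orP[].
  case: l l1 cutB => // k _ cutB h.
  have [||i ik|i ik E] := @mem_pack_cycle B j p k e _ _ _ h.
  - by rewrite cutB ?mem_head //; lia.
  - by rewrite cutB ?in_cons ?mem_cuts_head ?orbT //; lia.
  - rewrite cutB ?in_cons; last lia.
    rewrite negb_or; apply/andP; split; first lia.
    by apply/negP => /cuts_ge; lia.
  - by exists i => //; lia.
move=> h; have [i ik|i ik E] := IH _ lam1 _ h; last by exists i => //; lia.
rewrite cutB ?in_cons; last lia.
by rewrite (_ : i == p = false) //; lia.
Qed.

Lemma mem_sym_arcs i : i < m -> (base_pt i, base_pt i.+1) \in cycle_arcs C.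
Proof.
move=> im; apply/(mem_cycle_arcsP 0); exists i; rewrite (perm_size pC) size_iota //.
by rewrite /base_pt (modn_small im).
Qed.

(** Neighbouring positions have different colours, so by [bits_inj] the layers at the two ends of a
    base edge determine the factor. A forward and a backward arc cannot coincide because 2 is
    nonzero modulo [m]. *)
Lemma pack_exists lam : all (leq 1) lam -> sumn lam = m ->
  exists Fs : seq (seq (seq nat)), [/\ size Fs = 4,
    {in Fs, forall cs, perm_eq (flatten cs) (iota 0 m.*2) /\
                       perm_eq (map size cs) (map double lam)},
    uniq (flatten (map (@factor_arcs nat) Fs)) &
    {in flatten (map (@factor_arcs nat) Fs), forall e, (e.1./2, e.2./2) \in sym_arcs C}].
Proof.
move=> l1 Em; pose B := cuts 0 lam.
have m0 : 0 < m by lia.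
have arcP j e : e \in factor_arcs (pack_factor j 0 lam) -> exists2 i, i < m & pack_arc B j i e.
  move=> h; have [i|i ik E] := @mem_pack_factor B j 0 lam e l1 _ h; last first.
    by exists i => //; rewrite -Em.
  rewrite add0n Em /cut => /= i_m; have [->|im] : i = m \/ i < m by lia.
  2: by rewrite modn_small.
  rewrite modnn /B mem_cuts_head; apply/esym.
  rewrite -Em -[sumn lam]add0n; elim: (lam) 0 => [|l s IH] p /=.
    by rewrite addn0 mem_head.
  by rewrite addnA in_cons IH orbT.
have vhalf i b : (vtx i b)./2 = base_pt i by rewrite /vtx; case: b; lia.
have vS i b : vtx i.+1 b = vtx (i.+1 %% m) b by rewrite vtx_modm.
have Sm i : i.+1 %% m < m by rewrite ltn_mod.
exists [seq pack_factor j 0 lam | j <- iota 0 4]; split.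
- by rewrite size_map.
- by move=> cs /mapP[j _ ->]; split; [apply: pack_factor_flatten | rewrite size_pack_factor].
- rewrite -map_comp; apply: uniq_flatten_map; first exact: iota_uniq.
    move=> j _; apply: (@map_uniq _ _ (@fst nat nat)).
    by rewrite -/(unzip1 _) unzip1_factor_arcs (perm_uniq (pack_factor_flatten _ l1 Em)) iota_uniq.
  move=> j j'; rewrite !mem_iota /= => j4 j'4 e /arcP[i im h] /arcP[i' i'm h'].
  have key : i = i' -> layer j i = layer j' i -> layer j i.+1 = layer j' i.+1 -> j = j'.
    move=> _; rewrite /layer (modn_small im); apply: bits_inj => //.
    + by rewrite /colour; case: ifP => // _; case: odd.
    + by rewrite /colour; case: ifP => // _; case: odd.
    + exact: colour_neq.
  have nowrap : i = i'.+1 %% m -> i.+1 %% m = i' -> False.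
    have [E|E] := eqVneq i'.+1 m; have [E'|E'] := eqVneq i.+1 m;
      rewrite ?E ?E' ?modnn ?modn_small //; lia.
  case: h h' => -> [] [].
  + move=> /vtx_inj-/(_ im i'm)[ii]; rewrite -ii => /addIb t1.
    by rewrite !vS => /vtx_inj-/(_ (Sm _) (Sm _))[_ t2]; apply: key.
  + rewrite vS => /vtx_inj-/(_ im (Sm _))[E _]; rewrite vS.
    by move=> /vtx_inj-/(_ (Sm _) i'm)[E' _]; case: (nowrap).
  + rewrite vS => /vtx_inj-/(_ (Sm _) i'm)[E _]; rewrite vS.
    by move=> /vtx_inj-/(_ im (Sm _))[E' _]; case: (nowrap).
  + rewrite !vS => /vtx_inj-/(_ (Sm _) (Sm _))[ii]; move=> t2.
    move=> /vtx_inj-/(_ im i'm)[ii' /negb_inj t1]; apply: key => //; first by rewrite t1 -ii'.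
    by move: t2; rewrite -ii' => /addIb /negb_inj.
- move=> e; rewrite -map_comp => /flatten_mapP[j _ /arcP[i im]].
  rewrite /sym_arcs mem_cat; case=> -> /=; rewrite !vhalf.
    by rewrite mem_sym_arcs.
  apply/orP; right; apply/mapP; exists (base_pt i, base_pt i.+1) => //; exact: mem_sym_arcs.
Qed.
End Pack.

(** * Splicing cycles *)

(* Equalities between the edge multisets of paths and cycles are expressed as equalities
   of total weight for all symmetric weights; membership of an edge is recovered from the
   weight [edge_ind]. *)
Definition path_weight (w : nat -> nat -> nat) (s : seq nat) := \sum_(e <- path_arcs s) w e.1 e.2.
Definition cycle_weight (w : nat -> nat -> nat) (c : seq nat) := path_weight w (rcons c (head 0 c)).
Definition sym (w : nat -> nat -> nat) := forall x y, w x y = w y x.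

Lemma path_weight1 w x : path_weight w [:: x] = 0. Proof. by rewrite /path_weight big_nil. Qed.
Lemma path_weight_cons w x y s : path_weight w [:: x, y & s] = w x y + path_weight w (y :: s).
Proof. by rewrite /path_weight big_cons. Qed.

Lemma path_weight_split w s y t : path_weight w (s ++ y :: t) = path_weight w (rcons s y) + path_weight w (y :: t).
Proof.
elim: s => [|x [|z s] IH]; first by rewrite /= path_weight1.
  by rewrite /= !path_weight_cons path_weight1 addn0.
by rewrite !rcons_cons !cat_cons !path_weight_cons -cat_cons IH addnA.
Qed.

Lemma path_weight_rev w s : sym w -> path_weight w (rev s) = path_weight w s.
Proof.
move=> ws; rewrite /path_weight path_arcs_rev; apply: etrans (perm_big _ _) _.
  by apply/permPl; apply: perm_rev.
by rewrite big_map; apply: eq_bigr => e _ /=.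
Qed.

Lemma cycle_weight_cycle_arcs w c : cycle_weight w c = \sum_(e <- cycle_arcs c) w e.1 e.2.
Proof.
rewrite /cycle_weight /path_weight; case: c => [|x s]; first by rewrite big_nil.
by rewrite cycle_arcs_cons -cats1 cat_cons path_arcs_cat cats1.
Qed.

(** With this symmetric weight, the weight identities become equalities of counts for every
    predicate, hence permutations of arc lists. *)
Lemma cycle_weight_sym_arcs P c : count P (sym_arcs c) = cycle_weight (fun x y => P (x, y) + P (y, x)) c.
Proof.
rewrite cycle_weight_cycle_arcs /sym_arcs count_cat count_map big_split /=.
congr (_ + _); rewrite -sum1_count big_mkcond /=.
  by apply: eq_bigr => -[x y] _ /=; case: (P _).
by apply: eq_bigr => -[x y] _; rewrite /swap /=; case: (P _).
Qed.

Definition edge_ind (u v x y : nat) : nat := ((x, y) == (u, v)) || ((x, y) == (v, u)).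

Lemma edge_ind_sym u v : sym (edge_ind u v).
Proof. by move=> x y; rewrite /edge_ind !xpair_eqE orbC; congr (nat_of_bool (_ || _)); apply: andbC. Qed.


Lemma path_arcs_split (e : nat * nat) s : e \in path_arcs s -> exists s1 s2, s = s1 ++ [:: e.1, e.2 & s2].
Proof.
elim: s => [|x [|y s] IH] //; rewrite in_cons => /orP[/eqP->|/IH[s1 [s2 ->]]].
  by exists [::], s.
by exists (x :: s1), s2.
Qed.

Lemma path_weight_rcons w s x y : path_weight w (rcons (rcons s x) y) = path_weight w (rcons s x) + w x y.
Proof. by rewrite -cats1 cat_rcons path_weight_split path_weight_cons path_weight1 addn0. Qed.

Lemma open_arc w0 c : 0 < cycle_weight w0 c ->
  exists x y s, [/\ 0 < w0 x y, perm_eq (y :: s) c, last y s = x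
              & forall w, path_weight w (y :: s) + w x y = cycle_weight w c].
Proof.
move=> h0; have h := h0; rewrite /cycle_weight /path_weight in h.
have [e ein he] : exists2 e, e \in path_arcs (rcons c (head 0 c)) & 0 < w0 e.1 e.2.
  apply/hasP; apply: contraTT h => /hasPn h; rewrite -leqNgt leqn0; apply/eqP.
  by rewrite big_seq; apply: big1 => e /h; rewrite -leqNgt leqn0 => /eqP.
case: e ein he => x y /path_arcs_split[s1 [s2 E]] he; rewrite [_.1]/= [_.2]/= in E he.
exists x, y; case: c h h0 E => [|p c] h h0 E.
  by have := congr1 size E; rewrite size_cat /=; lia.
move: {h h0} E => E.
rewrite [head _ _]/= in E.
case/lastP: s2 => [|s2 q] in E *.
  have /eqP : rcons (p :: c) p = rcons (rcons s1 x) y by rewrite E -!cats1 -catA.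
  rewrite eqseq_rcons => /andP[/eqP E1 /eqP E2]; subst y.
  exists c; split=> //.
    by have := congr1 (last p) E1; rewrite last_rcons.
  by move=> w; rewrite /cycle_weight [head _ _]/= E1 path_weight_rcons.
have /eqP : rcons (p :: c) p = rcons (s1 ++ [:: x, y & s2]) q by rewrite E -!cats1 -!catA.
rewrite eqseq_rcons => /andP[/eqP E1 /eqP E2]; subst q.
exists (s2 ++ s1 ++ [:: x]); split=> //.
- rewrite E1 -cat_cons perm_catC -catA perm_cat2l perm_sym.
  by rewrite -[x :: _]/([:: x] ++ _).
- by rewrite !last_cat.
move=> w; rewrite /cycle_weight E; case: s1 E1 {E} => [|p' s1] [<- E1]; rewrite ?cat0s.
  by rewrite path_weight_cons cats1 addnC.
rewrite (_ : y :: _ = (y :: s2) ++ p :: (s1 ++ [:: x])) // !path_weight_split path_weight_cons cats1.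
by rewrite !rcons_cons; lia.
Qed.

Lemma open_edge u v c : 0 < cycle_weight (edge_ind u v) c ->
  exists s, [/\ perm_eq s c, head 0 s = u, last 0 s = v, s != [::]
              & forall w, sym w -> path_weight w s + w u v = cycle_weight w c].
Proof.
case/open_arc => x [y [s [h p l W]]].
move: h; rewrite /edge_ind; case: (altP (_ =P _)) => [[<- <-] _|_].
  exists (rev (y :: s)); split.
  - by rewrite perm_rev.
  - by rewrite -nth0 nth_rev // subn1 /= nth_last.
  - by rewrite rev_cons last_rcons.
  - by rewrite -size_eq0 size_rev.
  - by move=> w sw; rewrite path_weight_rev // W.
case: (altP (_ =P _)) => [[<- <-] _|_] //.
by exists (y :: s); split=> // w sw; rewrite -W sw.
Qed.

Lemma path_weight_catE w s t : s != [::] -> t != [::] ->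
  path_weight w (s ++ t) = path_weight w s + w (last 0 s) (head 0 t) + path_weight w t.
Proof.
case/lastP: s => // s x _; case: t => // y t _.
by rewrite path_weight_split path_weight_rcons last_rcons.
Qed.

Lemma cycle_weightE w s : s != [::] -> cycle_weight w s = path_weight w s + w (last 0 s) (head 0 s).
Proof. by case/lastP: s => // s x _; rewrite /cycle_weight path_weight_rcons last_rcons. Qed.

Lemma head_rev (s : seq nat) : head 0 (rev s) = last 0 s.
Proof. by case/lastP: s => // s x; rewrite rev_rcons last_rcons. Qed.

Lemma last_rev (s : seq nat) : last 0 (rev s) = head 0 s.
Proof. by case: s => // x s; rewrite rev_cons last_rcons. Qed.

(** Opening the cycles and gluing the second path reversed gives u ... v v' ... u', whose new edges
    are v v' and u' u. The reversal is the reason for symmetric weights. *)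
Lemma splice_cycles c1 c2 u v u' v' : 0 < cycle_weight (edge_ind u v) c1 -> 0 < cycle_weight (edge_ind u' v') c2 ->
  exists2 c, perm_eq c (c1 ++ c2) & forall w, sym w ->
    cycle_weight w c + w u v + w u' v' = cycle_weight w c1 + cycle_weight w c2 + w u u' + w v v'.
Proof.
move=> /open_edge[s1 [p1 h1 l1 n1 W1]] /open_edge[s2 [p2 h2 l2 n2 W2]].
have nr : rev s2 != [::] by rewrite -size_eq0 size_rev size_eq0.
exists (s1 ++ rev s2).
  by apply: perm_cat => //; rewrite perm_rev.
move=> w sw; rewrite -W1 // -W2 // cycle_weightE; last by case: (s1) n1.
rewrite path_weight_catE // last_cat path_weight_rev // head_rev.
have -> : last (last 0 s1) (rev s2) = last 0 (rev s2) by case: (rev s2) nr.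
have -> : head 0 (s1 ++ rev s2) = head 0 s1 by case: (s1) n1.
rewrite last_rev h1 h2 l1 l2 (sw u' u); lia.
Qed.

Definition line (V : nat -> nat -> nat) M r := [seq V r t | t <- iota 0 M].

Lemma line_edge V M r s : s.+1 < M -> 0 < cycle_weight (edge_ind (V r s) (V r s.+1)) (line V M r).
Proof.
move=> sM; have -> : line V M r = [seq V r t | t <- iota 0 s] ++
    [:: V r s, V r s.+1 & [seq V r t | t <- iota s.+2 (M - s.+2)]].
  rewrite /line (_ : M = s + (M - s.+2).+2); last by lia.
  rewrite iotaD map_cat add0n; congr (_ ++ _) => /=.
  by rewrite (_ : s + (M - s.+2).+2 - s.+2 = M - s.+2) //; lia.
by rewrite /cycle_weight rcons_cat !rcons_cons path_weight_split path_weight_cons /edge_ind eqxx; lia.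
Qed.

(** The lines are attached to [c0] one after another. Each square needs an edge of the line attached
    last that the preceding exchange has left intact, whence [s r.+1 != s r]. *)
Lemma chain_lines V M s R0 n c0 :
  (forall r r' t t', r <= R0 + n -> r' <= R0 + n -> t < M -> t' < M ->
     V r t = V r' t' -> r = r' /\ t = t') ->
  (forall r, R0 <= r < R0 + n -> (s r).+1 < M) ->
  (forall r, R0 <= r -> r.+1 < R0 + n -> s r.+1 != s r) ->
  (0 < n -> 0 < cycle_weight (edge_ind (V R0 (s R0)) (V R0 (s R0).+1)) c0) ->
  exists2 c, perm_eq c (c0 ++ flatten [seq line V M r | r <- iota R0.+1 n])
   & forall w, sym w ->
     cycle_weight w c + \sum_(R0 <= r < R0 + n)
       (w (V r (s r)) (V r (s r).+1) + w (V r.+1 (s r)) (V r.+1 (s r).+1))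
     = cycle_weight w c0 + \sum_(R0 <= r < R0 + n) cycle_weight w (line V M r.+1)
     + \sum_(R0 <= r < R0 + n)
       (w (V r (s r)) (V r.+1 (s r)) + w (V r (s r).+1) (V r.+1 (s r).+1)).
Proof.
move=> Vi sM sn e0.
(* The induction also records the edges of the last line that are still present: all but the one
   just exchanged. Before any line is attached, only the edge assumed of [c0] is known. *)
suff: exists c, [/\ perm_eq c (c0 ++ flatten [seq line V M r | r <- iota R0.+1 n]),
    forall w, sym w -> 
     cycle_weight w c + \sum_(R0 <= r < R0 + n)
       (w (V r (s r)) (V r (s r).+1) + w (V r.+1 (s r)) (V r.+1 (s r).+1))
     = cycle_weight w c0 + \sum_(R0 <= r < R0 + n) cycle_weight w (line V M r.+1)
     + \sum_(R0 <= r < R0 + n)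
       (w (V r (s r)) (V r.+1 (s r)) + w (V r (s r).+1) (V r.+1 (s r).+1))
    & forall t, t.+1 < M -> (0 < n -> t != s (R0 + n).-1) -> (n = 0 -> t = s R0 /\ 0 < cycle_weight (edge_ind (V R0 t) (V R0 t.+1)) c0)
         -> 0 < cycle_weight (edge_ind (V (R0 + n) t) (V (R0 + n) t.+1)) c].
  by case=> c [pc W _]; exists c.
elim: n Vi sM sn e0 => [|n IH] Vi sM sn e0.
  exists c0; rewrite /= cats0 addn0; split=> //.
    by move=> w _; rewrite !big_geq // !addn0.
  by move=> t _ _ /(_ erefl)[].
have [|r rn|r r0 rn|n0|c [pc W E]] := IH.
- by move=> r r' t t' hr hr'; apply: Vi; lia.
- by apply: sM; lia.
- by apply: sn; lia.
- exact: e0.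
set R := R0 + n in IH W E *; have sR : (s R).+1 < M by apply: sM; lia.
have cR : 0 < cycle_weight (edge_ind (V R (s R)) (V R (s R).+1)) c.
  apply: E => // [n0|n0]; last by rewrite /R n0 addn0; split=> //; apply: e0.
  rewrite /R -{1}(prednK n0) addnS eq_sym -addnS prednK // eq_sym.
  rewrite -[X in s X](prednK (n := R0 + n)); last by lia.
  by apply: sn; lia.
have [c' pc' W'] := splice_cycles cR (line_edge V R.+1 sR).
exists c'; split.
- apply: perm_trans pc' _; rewrite (_ : iota _ n.+1 = iota R0.+1 n ++ [:: R.+1]).
    by rewrite map_cat flatten_cat catA /= cats0 perm_cat2r.
  by rewrite -[n.+1]addn1 iotaD addSn.
- move=> w sw; move: (W w sw) (W' w sw).
  rewrite !addnS !big_nat_recr /= -?/R; lia.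
move=> t tM /(_ isT); rewrite addnS /= -/R => ts _.
have sy := edge_ind_sym (V R.+1 t) (V R.+1 t.+1).
have := W' _ sy; have := line_edge V R.+1 tM.
set w := edge_ind _ _.
have Vn r r' u u' : r <= R.+1 -> r' <= R.+1 -> u < M -> u' < M ->
    (r != r') || (u != u') -> (V r u == V r' u') = false.
  move=> hr hr' hu hu' h; apply/eqP => /Vi[]; rewrite ?addnS // => ??.
  by move: h; subst; rewrite !eqxx.
have -> : w (V R (s R)) (V R (s R).+1) = 0.
  by rewrite /w /edge_ind !xpair_eqE !Vn //; lia.
have -> : w (V R.+1 (s R)) (V R.+1 (s R).+1) = 0.
  rewrite /w /edge_ind !xpair_eqE; apply/eqP; rewrite eqb0; apply/negP.
  by case/orP => /andP[/eqP/Vi h1 /eqP/Vi h2]; move: h1 h2 ts; rewrite !addnS -/R; lia.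
lia.
Qed.

(** * The three-column gadget *)

Definition inner (f : nat -> nat) p q := [seq f j | j <- index_iota p.+1 q].

Lemma path_weight_iota w f p n : path_weight w [seq f j | j <- iota p n.+1] =
  \sum_(p <= j < p + n) w (f j) (f j.+1).
Proof.
elim: n p => [|n IH] p; first by rewrite addn0 big_geq // /= path_weight1.
rewrite (_ : map f _ = [:: f p, f p.+1 & [seq f j | j <- iota p.+2 n]]) //.
rewrite path_weight_cons big_ltn; last by lia.
by rewrite -[f p.+1 :: _]/[seq f j | j <- iota p.+1 n.+1] IH addSnnS.
Qed.

Lemma path_weight_inner w f p q : p < q ->
  path_weight w (f p :: rcons (inner f p q) (f q)) = \sum_(p <= j < q) w (f j) (f j.+1).
Proof.
move=> pq; rewrite {3}(_ : q = p + (q - p)); last by lia.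
rewrite -path_weight_iota (_ : (q - p).+1 = (q - p.+1).+2); last by lia.
rewrite (_ : iota p _ = p :: iota p.+1 (q - p.+1 + 1)) ?addn1 //.
rewrite -[(q - p.+1).+1]addn1 iotaD.
rewrite map_cons map_cat cats1.
by rewrite (_ : p.+1 + (q - p.+1) = q) //; lia.
Qed.

Lemma path_weight_rinner w f p q : sym w -> p < q ->
  path_weight w (f q :: rcons (rev (inner f p q)) (f p)) = \sum_(p <= j < q) w (f j) (f j.+1).
Proof.
move=> sw pq; rewrite -(path_weight_inner _ _ pq) -(path_weight_rev _ sw).
by rewrite rev_cons rev_rcons revK.
Qed.

Section Gadget.
Variable v : nat -> nat -> nat.

(* The part between v 0 2 and v (2k + 2) 0 of the column cycles after exchanging the
   squares at the columns 0, 1 for even rows and 1, 2 for odd rows; the only other pieces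
   on these rows are the edges v 0 0 -- v 0 1 and v (2k + 2) 1 -- v (2k + 2) 2. *)
Fixpoint zig k := if k is k'.+1 then zig k' ++
    [:: v k.*2 1; v k.*2 2; v k.*2.+1 2; v k.*2.+1 1; v k.*2.+1 0; v k.*2.+2 0]
  else [:: v 0 2; v 1 2; v 1 1; v 1 0; v 2 0].

Lemma zig_head k : exists s, zig k = v 0 2 :: s.
Proof.
elim: k => [|k [s E]]; first by eexists.
by rewrite [zig _]/= E; eexists.
Qed.

Lemma zig_last k : exists s, zig k = rcons s (v k.*2.+2 0).
Proof.
case: k => [|k]; first by exists [:: v 0 2; v 1 2; v 1 1; v 1 0].
exists (zig k ++ [:: v k.+1.*2 1; v k.+1.*2 2; v k.+1.*2.+1 2; v k.+1.*2.+1 1; v k.+1.*2.+1 0]).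
by rewrite -cats1 -catA.
Qed.

(* The square of the rows r, r + 1 and the columns t, t + 1: its row and its column edges. *)
Definition hor (w : nat -> nat -> nat) r t := w (v r t) (v r t.+1) + w (v r.+1 t) (v r.+1 t.+1).
Definition ver (w : nat -> nat -> nat) r t := w (v r t) (v r.+1 t) + w (v r t.+1) (v r.+1 t.+1).

(** Three column segments, with the column edges of the squares traded for their row edges, are
    [zig] and two stray edges. Each induction step adds an even and an odd row, after which the path
    is back in column 0. *)
Lemma zig_pw w k : sym w ->
  w (v 0 0) (v 0 1) + path_weight w (zig k) + w (v k.*2.+2 1) (v k.*2.+2 2)
    + \sum_(0 <= r < k.*2.+2) ver w r (odd r)
  = \sum_(0 <= j < k.*2.+2) w (v j 0) (v j.+1 0)
  + \sum_(0 <= j < k.*2.+2) w (v j 1) (v j.+1 1)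
  + \sum_(0 <= j < k.*2.+2) w (v j 2) (v j.+1 2)
  + \sum_(0 <= r < k.*2.+2) hor w r (odd r).
Proof.
move=> sw; elim: k => [|k IH].
  rewrite !big_nat_recr //= !big_geq // !path_weight_cons path_weight1 /hor /ver /=.
  rewrite (sw (v 1 2) (v 1 1)) (sw (v 1 1) (v 1 0)). rewrite double0; lia.
have [s E] := zig_last k.
have -> : path_weight w (zig k.+1) = path_weight w (zig k) + w (v k.+1.*2 0) (v k.+1.*2 1) +
    w (v k.+1.*2 1) (v k.+1.*2 2) + w (v k.+1.*2 2) (v k.+1.*2.+1 2) +
    w (v k.+1.*2.+1 1) (v k.+1.*2.+1 2) + w (v k.+1.*2.+1 0) (v k.+1.*2.+1 1) +
    w (v k.+1.*2.+1 0) (v k.+1.*2.+2 0).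
  rewrite [zig k.+1]/= E cat_rcons path_weight_split !path_weight_cons path_weight1 doubleS.
  rewrite (sw (v k.*2.+3 2) (v k.*2.+3 1)) (sw (v k.*2.+3 1) (v k.*2.+3 0)); lia.
move: IH; rewrite doubleS; set K := k.*2.
rewrite !(@big_nat_recr _ _ _ K.+3) // !(@big_nat_recr _ _ _ K.+2) //=.
rewrite /hor /ver /= !odd_double /=; lia.
Qed.

Lemma zig_perm k : perm_eq ([:: v 0 0; v 0 1; v k.*2.+2 1; v k.*2.+2 2] ++ zig k)
  (flatten [seq [seq v j t | j <- iota 0 k.*2.+3] | t <- iota 0 3]).
Proof.
apply/permP => P; elim: k => [|k]; first by rewrite double0 /=; lia.
rewrite doubleS; set K := k.*2.
have E t : [seq v j t | j <- iota 0 K.+2.+3] =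
    [seq v j t | j <- iota 0 K.+3] ++ [:: v K.+3 t; v K.+4 t].
  by rewrite -[K.+2.+3]addn2 iotaD map_cat.
have F (f : nat -> seq nat) : flatten [seq f t | t <- iota 0 3] = f 0 ++ f 1 ++ f 2.
  by rewrite /= cats0.
rewrite !F !E [zig k.+1]/= doubleS -/K !count_cat.
rewrite [count P [:: _; _; _; _]]/= [count P [:: v 0 0; _; _; _]]/=.
do 3!move: (count P (map _ _)) => ?; move: (count P (zig k)) => ?.
rewrite [count P [:: v _ 1, _ & _]]/= [count P [:: v K.+3 0; _]]/=.
rewrite [count P [:: v K.+3 1; _]]/= [count P [:: v K.+3 2; _]]/=; clear; lia_count.
Qed.
End Gadget.

(** * Grids of cosets *)

(** A row is a coset of the subgroup generated by [a]. Row indices may exceed the number of cosets: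
    the rows then recur, shifted along themselves. *)
Definition grid m a b r t := (r * b + t * a) %% m.
Definition diff_weight m (w : nat -> nat -> nat) d := \sum_(x <- iota 0 m) w x ((x + d) %% m).

Lemma gridC m a b r t : grid m a b r t = grid m b a t r.
Proof. by rewrite /grid addnC. Qed.

Lemma cycle_weight_line w V M r : 0 < M -> V r M = V r 0 ->
  cycle_weight w (line V M r) = \sum_(0 <= t < M) w (V r t) (V r t.+1).
Proof.
case: M => // M _ E; rewrite /cycle_weight.
rewrite (_ : rcons _ _ = [seq V r t | t <- iota 0 M.+2]); first by rewrite path_weight_iota.
by rewrite -[M.+2]addn1 iotaD map_cat /= E cats1.
Qed.

Section Grid.
Variables m a b : nat.
Hypotheses (m0 : 0 < m) (cab : coprime (gcdn a b) m).
Let g := gcdn a m.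
Let M := m %/ g.
Notation v := (grid m a b).

Lemma rows_gt0 : 0 < g. Proof. by rewrite gcdn_gt0 m0 orbT. Qed.
Lemma rows_cols : g * M = m. Proof. by rewrite mulnC divnK // dvdn_gcdr. Qed.
Lemma cols_gt0 : 0 < M. Proof. by move: m0; rewrite -{1}rows_cols muln_gt0 => /andP[]. Qed.

Lemma grid_per r t : v r (t + M) = v r t.
Proof.
rewrite /grid mulnDl addnA; apply/eqP.
rewrite -[X in _ == X %[mod _]]addn0 eqn_modDl mod0n -/(dvdn _ _).
by rewrite -{1}rows_cols mulnC dvdn_pmul2l ?cols_gt0 // dvdn_gcdl.
Qed.

(** Modulo [g] the column index disappears and [b] is invertible, which fixes the row; then [a %/ g]
    is invertible modulo [M], which fixes the column. *)
Lemma grid_inj r r' t t' : r < g -> r' < g -> t < M -> t' < M ->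
  v r t = v r' t' -> r = r' /\ t = t'.
Proof.
move=> rg r'g tM t'M E.
have ag : g %| a by rewrite dvdn_gcdl.
have mg : g %| m by rewrite dvdn_gcdr.
have cbg : coprime g b.
  by rewrite /coprime /g -gcdnA (gcdnC m) gcdnA.
have Er : r = r'.
  have /eqP := congr1 (modn^~ g) E; rewrite /grid !(modn_dvdm _ mg).
  have e i j : (i * b + j * a) %% g = (i * b) %% g.
    by rewrite -modnDmr -modnMmr (eqP ag) muln0 mod0n addn0.
  rewrite !e.
  wlog le : r r' rg r'g {E} / r <= r'.
    move=> H; case/orP: (leq_total r r') => h E'; first exact: H.
    by symmetry; apply: H => //; rewrite eq_sym.
  rewrite eq_sym eqn_mod_dvd; last by rewrite leq_mul2r le orbT.
  rewrite -mulnBl Gauss_dvdl // => /dvdn_leq; lia.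
split=> //; subst r'; move/eqP: E; rewrite /grid eqn_modDl.
have cM : coprime M (a %/ g).
  rewrite coprime_sym /coprime -(eqn_pmul2r rows_gt0) muln_gcdl mul1n.
  by rewrite divnK // [M * g]mulnC rows_cols.
wlog le : t t' tM t'M / t <= t'.
  move=> H; case/orP: (leq_total t t') => h E; first exact: H.
  by symmetry; apply: H => //; rewrite eq_sym.
rewrite eq_sym eqn_mod_dvd; last by rewrite leq_mul2r le orbT.
rewrite -mulnBl -{1}rows_cols -(divnK ag) (mulnC (a %/ g)) mulnCA dvdn_pmul2l ?rows_gt0 //.
rewrite Gauss_dvdl // => /dvdn_leq; lia.
Qed.

Lemma grid_perm : perm_eq (flatten [seq line v M r | r <- iota 0 g]) (iota 0 m).
Proof.
have -> : flatten [seq line v M r | r <- iota 0 g] =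
  [seq v r t | r <- iota 0 g, t <- iota 0 M] by [].
have sz : size [seq v r t | r <- iota 0 g, t <- iota 0 M] = m.
  by rewrite size_allpairs !size_iota rows_cols.
have un : uniq [seq v r t | r <- iota 0 g, t <- iota 0 M].
  apply: allpairs_uniq; rewrite ?iota_uniq // => x y.
  move=> /allpairsP[[r t] [rg tM ->]] /allpairsP[[r' t'] [r'g t'M ->]] /=.
  rewrite !mem_iota /= !add0n in rg tM r'g t'M *.
  by case/grid_inj => // -> ->.
apply: uniq_perm => //; first exact: iota_uniq.
have sub : {subset [seq v r t | r <- iota 0 g, t <- iota 0 M] <= iota 0 m}.
  by move=> x /allpairsP[p [_ _ ->]]; rewrite mem_iota /= ltn_mod.
by have [] := uniq_min_size un sub; rewrite ?sz ?size_iota.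
Qed.

Lemma grid_dw w : \sum_(0 <= r < g) cycle_weight w (line v M r) = diff_weight m w a.
Proof.
rewrite /diff_weight -(perm_big _ grid_perm) big_flatten /= big_map /index_iota subn0.
apply: eq_bigr => r _; rewrite cycle_weight_line ?cols_gt0 //; last by rewrite -(grid_per r 0).
rewrite /line big_map /index_iota subn0; apply: eq_bigr => t _; congr w.
by rewrite /grid modnDml -addnA mulSn (addnC a).
Qed.

(** The squares may be placed freely as long as consecutive ones use different columns; this freedom
    lets the same squares merge the columns too. *)
Lemma tree_cycle (s : nat -> nat) :
  (forall r, r.+1 < g -> (s r).+1 < M) ->
  (forall r, r.+2 < g -> s r.+1 != s r) ->
  exists2 c, perm_eq c (iota 0 m) & forall w, sym w ->
    cycle_weight w c + \sum_(0 <= r < g.-1) hor v w r (s r) =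
    diff_weight m w a + \sum_(0 <= r < g.-1) ver v w r (s r).
Proof.
move=> sM sn; have g0 := rows_gt0.
have [||||c pc W] := @chain_lines v M s 0 g.-1 (line v M 0).
- by move=> r r' t t' hr hr' tM t'M; apply: grid_inj => //; lia.
- by move=> r hr; apply: sM; lia.
- by move=> r hr hr'; apply: sn; lia.
- by move=> g1; apply: line_edge; apply: sM; lia.
exists c.
  apply: perm_trans pc _; apply: perm_trans grid_perm.
  by rewrite -{2}(prednK g0).
move=> w sw; rewrite -grid_dw -{2}(prednK g0) big_nat_recl //.
by have := W w sw; rewrite !add0n.
Qed.
End Grid.

Lemma count_inner (P : pred nat) f p q r : p <= q < r ->
  count P [seq f j | j <- index_iota p r] =
  count P [seq f j | j <- index_iota p q.+1] + count P (inner f q r).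
Proof.
move=> h; rewrite /inner /index_iota -count_cat -map_cat.
rewrite (_ : r - p = (q.+1 - p) + (r - q.+1)); last by lia.
by rewrite iotaD (_ : p + (q.+1 - p) = q.+1) //; lia.
Qed.

Lemma sum_split F p q r : p <= q <= r ->
  \sum_(p <= j < r) F j = \sum_(p <= j < q) F j + \sum_(q <= j < r) F j :> nat.
Proof. by move=> /andP[h h']; rewrite (big_cat_nat h h'). Qed.

(** The last clause says that column 2 is intact from row [K.*2.+2] on, where the staircase of
    further squares starts. *)
Lemma base_cycle (v : nat -> nat -> nat) L K : K.*2.+2 < L ->
  (forall i, v L i = v 0 i) ->
  exists c, [/\ perm_eq c (flatten [seq [seq v j i | j <- iota 0 L] | i <- iota 0 3]),
    forall w, sym w -> cycle_weight w c + \sum_(0 <= r < K.*2.+2) ver v w r (odd r) =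
      \sum_(0 <= i < 3) \sum_(0 <= j < L) w (v j i) (v j.+1 i)
      + \sum_(0 <= r < K.*2.+2) hor v w r (odd r)
    & forall w, sym w ->
      \sum_(K.*2.+2 <= j < L) w (v j 2) (v j.+1 2) <= cycle_weight w c].
Proof.
set q := K.*2.+2 => qL vL.
pose W i := inner (v^~ i) q L.
(* Column 1 is run backwards to row [q], column 2 forwards to its end at [v 0 2], then the gadget
   leads to [v q 0] and column 0 closes the cycle. *)
pose c := [:: v 0 0; v 0 1] ++ rev (W 1) ++ [:: v q 1; v q 2] ++ W 2 ++ zig v K ++ W 0.
have wc w : sym w -> cycle_weight w c = w (v 0 0) (v 0 1) + \sum_(q <= j < L) w (v j 1) (v j.+1 1)
   + w (v q 1) (v q 2) + \sum_(q <= j < L) w (v j 2) (v j.+1 2) + path_weight w (zig v K)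
   + \sum_(q <= j < L) w (v j 0) (v j.+1 0).
  move=> sw; rewrite /cycle_weight /c [head _ _]/=; have [z1 E1] := zig_head v K.
  have [z2 E2] := zig_last v K; rewrite -/q in E2.
  rewrite E1 !rcons_cat !cat_cons !cat0s path_weight_cons.
  rewrite -[v 0 1 :: _]cat_cons path_weight_split path_weight_cons -[v q 2 :: _]cat_cons path_weight_split.
  rewrite -cat_cons -E1 E2 cat_rcons path_weight_split -E2 !rcons_cons.
  rewrite -(path_weight_rinner (v^~ 1) sw qL) -(path_weight_inner w (v^~ 2) qL).
  by rewrite -(path_weight_inner w (v^~ 0) qL) !vL /W; lia.
exists c; split.
- apply/permP => P; have := permP (zig_perm v K) P.
  have F (f : nat -> seq nat) : flatten [seq f t | t <- iota 0 3] = f 0 ++ f 1 ++ f 2.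
    by rewrite /= cats0.
  rewrite !F /c !count_cat count_rev /W.
  have E i := count_inner P (v^~ i) (p := 0) (q := q) (r := L).
  rewrite /index_iota !subn0 in E; rewrite !E //.
  rewrite -/q [count P [:: v 0 0; _]]/= [count P [:: v 0 0; _; _; _]]/=.
  rewrite [count P [:: v q 1; _]]/=; clear; lia_count.
- move=> w sw; rewrite wc //; have := zig_pw v K sw; rewrite -/q.
  rewrite !(@big_nat_recr _ _ _ 2) // !(@big_nat_recr _ _ _ 1) //= big_nat1.
  rewrite !(@sum_split _ 0 q L) ?(ltnW qL) //; lia.
- by move=> w sw; rewrite wc //; lia.
Qed.

(* The case where the three columns lie on one cycle f, at distance a from each other. *)
Lemma base_cycle1 (f : nat -> nat) m a K : K.*2.+2 < a -> a.*2 + K.*2.+2 < m ->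
  f m = f 0 -> exists c, [/\ perm_eq c [seq f j | j <- iota 0 m]
   & forall w, sym w ->
     cycle_weight w c + \sum_(0 <= r < K.*2.+2) ver (fun j i => f (j + i * a)) w r (odd r) =
     \sum_(0 <= j < m) w (f j) (f j.+1)
     + \sum_(0 <= r < K.*2.+2) hor (fun j i => f (j + i * a)) w r (odd r)].
Proof.
set q := K.*2.+2 => qa am fm; pose v j i := f (j + i * a).
have qa2 : a + q < a.*2 by lia.
(* The third segment is run forwards to [f m = f 0], the first backwards from [f a] to [f q], the
   gadget backwards to [f a.*2], and the second segment backwards to [f (a + q)]. *)
pose c := [:: v q 1; v q 2] ++ inner f (a.*2 + q) m ++ [:: v 0 0; v 0 1]
  ++ rev (inner f q a) ++ rev (zig v K) ++ rev (inner f (a + q) a.*2).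
have vE : [/\ v 0 0 = f 0, v 0 1 = f a, v 0 2 = f a.*2 & v q 0 = f q] /\
          v q 1 = f (a + q) /\ v q 2 = f (a.*2 + q).
  by rewrite /v !mul0n !mul1n mul2n !addn0 !add0n addnC (addnC q).
have wc w : sym w -> cycle_weight w c = w (v 0 0) (v 0 1) + w (v q 1) (v q 2) + path_weight w (zig v K)
   + \sum_(q <= j < a) w (f j) (f j.+1) + \sum_(a + q <= j < a.*2) w (f j) (f j.+1)
   + \sum_(a.*2 + q <= j < m) w (f j) (f j.+1).
  move=> sw; rewrite /cycle_weight /c [head _ _]/=; have [z1 E1] := zig_head v K.
  have [z2 E2] := zig_last v K; rewrite -/q in E2.
  rewrite -(path_weight_rev (zig v K) sw).
  have E3 : rev (zig v K) = v q 0 :: rev z2 by rewrite E2 rev_rcons.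
  have E4 : rev (zig v K) = rcons (rev z1) (v 0 2) by rewrite E1 rev_cons.
  rewrite E3 !rcons_cat !cat_cons !cat0s path_weight_cons.
  rewrite -[v q 2 :: _]cat_cons path_weight_split path_weight_cons -[v 0 1 :: _]cat_cons path_weight_split.
  rewrite -cat_cons -E3 E4 cat_rcons path_weight_split -E4 !rcons_cons.
  rewrite -(path_weight_rinner f sw qa2) -(path_weight_rinner f sw qa) -(path_weight_inner w f am) fm.
  by case: vE => [[-> -> -> ->] [-> ->]]; lia.
exists c; split.
- apply/permP => P; have := permP (zig_perm v K) P.
  have F (h : nat -> seq nat) : flatten [seq h t | t <- iota 0 3] = h 0 ++ h 1 ++ h 2.
    by rewrite /= cats0.
  rewrite !F /c !count_cat !count_rev.
  have S i : [seq v j i | j <- iota 0 q.+1] = [seq f j | j <- index_iota (i * a) (i * a + q).+1].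
    rewrite /index_iota (_ : (i * a + q).+1 - i * a = q.+1); last by lia.
    by rewrite -[i * a in RHS]addn0 iotaDl -map_comp; apply: eq_map => j; rewrite /= /v addnC.
  rewrite -/q !S mul0n mul1n mul2n !add0n.
  have -> : iota 0 m = index_iota 0 a ++ index_iota a a.*2 ++ index_iota a.*2 m.
    rewrite /index_iota subn0 -addnn addnK catA -iotaD -iotaD; congr iota; lia.
  rewrite !map_cat !count_cat.
  rewrite (@count_inner P f 0 q a) // (@count_inner P f a (a + q) a.*2); last by lia.
  rewrite (@count_inner P f a.*2 (a.*2 + q) m); last by lia.
  rewrite [count P [:: v 0 0; _]]/= [count P [:: v 0 0; _; _; _]]/=.
  rewrite [count P [:: v q 1; _]]/=; clear; lia_count.
- move=> w sw; rewrite wc //; have := zig_pw v K sw; rewrite -/q -/v.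
  rewrite (@sum_split _ 0 a m); last by lia.
  rewrite (@sum_split _ a a.*2 m); last by lia.
  rewrite (@sum_split _ 0 q a) ?(ltnW qa) // (@sum_split _ a (a + q) a.*2); last by lia.
  rewrite (@sum_split _ a.*2 (a.*2 + q) m); last by lia.
  have S i : \sum_(0 <= j < q) w (v j i) (v j.+1 i) =
      \sum_(i * a <= j < i * a + q) w (f j) (f j.+1).
    rewrite -{1}[i * a]add0n (addnC _ q) big_addn addnK; apply: eq_bigr => j _.
    by rewrite /v addSn.
  rewrite !S mul0n mul1n mul2n !add0n; lia.
Qed.

(** * Hamilton decompositions *)

Definition two_ham m a b := exists A B, [/\ perm_eq A (iota 0 m), perm_eq B (iota 0 m)
  & forall w, sym w -> cycle_weight w A + cycle_weight w B = diff_weight m w a + diff_weight m w b].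

(** With [b = 0] the grid has a single row, so no exchange takes place. *)
Lemma single_ham m d : 0 < m -> coprime d m ->
  exists2 c, perm_eq c (iota 0 m) & forall w, sym w -> cycle_weight w c = diff_weight m w d.
Proof.
move=> m0 cd; have := @tree_cycle m d 0 m0 _ (fun=> 0).
rewrite gcdn0 (eqP cd) => /(_ cd); case=> // c pc W; exists c => // w sw.
by have := W w sw; rewrite !big_geq // !addn0.
Qed.

Lemma sum_shift F p q k :
  \sum_(p + k <= j < q + k) F j = \sum_(p <= j < q) F (k + j) :> nat.
Proof. by rewrite big_addn addnK; apply: eq_bigr => j _; rewrite addnC. Qed.

(* The columns 0, 1, 2 are merged by the gadget on the rows 0, ..., g - h + 2, the
   remaining ones by a staircase of squares; altogether one square for every pair of
   consecutive rows, as needed to merge the rows. *)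
Lemma two_ham_large m a b : odd m -> coprime (gcdn a b) m ->
  3 <= gcdn b m < gcdn a m -> two_ham m a b.
Proof.
move=> om cab; set g := gcdn a m; set h := gcdn b m => /andP[h3 hg].
have m0 : 0 < m by case: m om {cab g h h3 hg}.
have cba : coprime (gcdn b a) m by rewrite gcdnC.
have og : odd g by apply: dvdn_odd om; apply: dvdn_gcdr.
have oh : odd h by apply: dvdn_odd om; apply: dvdn_gcdr.
have hL := rows_cols m b; have rows_cols := rows_cols m a; rewrite -/g -/h in rows_cols hL.
set M := m %/ g in rows_cols; set L := m %/ h in hL.
(* A common divisor of [g] and [h] divides [gcdn a b] and [m], so they are coprime; the grid is thus
   wide and high enough for all squares. *)
have ghm : g * h <= m.
  apply: dvdn_leq => //; rewrite Gauss_dvd ?dvdn_gcdr //.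
  by rewrite /coprime /g /h gcdnACA gcdnn; exact: cab.
have h0 : 0 < h by apply: leq_trans h3.
have g0 : 0 < g by apply: leq_ltn_trans hg.
have hM : h <= M by rewrite -(leq_pmul2l g0) rows_cols.
have gL : g <= L by rewrite -(leq_pmul2l h0) hL mulnC.
pose K := (g - h)./2; have EK : g = K.*2 + h.
  by have := odd_double_half (g - h); rewrite oddB ?og ?oh // 1?ltnW //= /K; lia.
pose s r := if r < K.*2.+2 then odd r : nat else r - K.*2.
pose v := grid m a b; pose U := grid m b a.
have UE r j : U r j = v j r by rewrite /U gridC.
have [||A pA WA] := @tree_cycle m a b m0 cab s.
- rewrite -/g -/M => r rg; rewrite /s; case: ifP => _; last by lia.
  by case: (odd r); lia.
- rewrite -/g => r rg; rewrite /s /=; case: (ltnP r.+1 _) => h1.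
    by rewrite ifT; [case: (odd r) | lia].
  case: ifP => [h2|]; last by lia.
  have -> : r = K.*2.+1 by lia.
  by rewrite /= odd_double; lia.
have [||c0 [pc0 Wc0 ec0]] := @base_cycle v L K; first by lia.
  by move=> i; rewrite -!UE -[X in U i X]add0n; apply: grid_per.
have [||||B pB WB] := @chain_lines U L (fun r => K.*2 + r) 2 (h - 3) c0.
- by move=> r r' t t' hr hr' tL t'L; apply: grid_inj => //; rewrite -/h; lia.
- by move=> r hr; lia.
- by move=> r _ _; lia.
- move=> h4; rewrite addn2; set x := U 2 _; set y := U 2 _.
  have := ec0 _ (edge_ind_sym x y); rewrite big_ltn; last by lia.
  by rewrite -!UE -/x -/y {1}/edge_ind eqxx; lia.
have E1 : K.*2.+2 = 2 + K.*2 by rewrite addnC addn2.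
have E2 : g.-1 = h.-1 + K.*2 by move: EK h0; clear; lia.
have h3E : 2 + (h - 3) = h.-1 by lia.
rewrite h3E in WB.
exists A, B; split=> //.
- apply: perm_trans pB _; apply: perm_trans (grid_perm m0 cba).
  rewrite -/h -/L -/U (_ : h = 3 + (h - 3)); last by lia.
  rewrite iotaD map_cat flatten_cat addKn add0n perm_cat2r.
  apply: perm_trans pc0 _; rewrite (_ : map _ _ = map (line U L) (iota 0 3)) //.
  by apply: eq_map => i; apply: eq_map => j; rewrite UE.
move=> w sw; have := WA w sw; have := WB w sw; have := Wc0 w sw.
have -> : \sum_(0 <= i < 3) \sum_(0 <= j < L) w (v j i) (v j.+1 i) =
    \sum_(0 <= i < 3) cycle_weight w (line U L i).
  apply: eq_bigr => i _; rewrite cycle_weight_line ?cols_gt0 //.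
    by apply: eq_bigr => j _; rewrite !UE.
  by rewrite -[X in U i X]add0n; apply: grid_per.
have -> : \sum_(2 <= r < h.-1) (w (U r (K.*2 + r)) (U r (K.*2 + r).+1) +
    w (U r.+1 (K.*2 + r)) (U r.+1 (K.*2 + r).+1)) = 
   \sum_(K.*2.+2 <= r < g.-1) ver v w r (s r).
  rewrite E2 E1 sum_shift; apply: congr_big_nat => // r hr.
  rewrite /s ifN; last by move: (andP hr) => []; clear; lia.
  by rewrite addKn /ver !UE.
have -> : \sum_(2 <= r < h.-1) (w (U r (K.*2 + r)) (U r.+1 (K.*2 + r)) +
    w (U r (K.*2 + r).+1) (U r.+1 (K.*2 + r).+1)) = 
   \sum_(K.*2.+2 <= r < g.-1) hor v w r (s r).
  rewrite E2 E1 sum_shift; apply: congr_big_nat => // r hr.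
  rewrite /s ifN; last by move: (andP hr) => []; clear; lia.
  by rewrite addKn /hor !UE.
have S F : \sum_(0 <= r < g.-1) F r (s r) = \sum_(0 <= r < K.*2.+2) F r (odd r)
    + \sum_(K.*2.+2 <= r < g.-1) F r (s r) :> nat.
  rewrite (@sum_split _ 0 K.*2.+2 g.-1); last by lia.
  congr (_ + _); rewrite big_nat [RHS]big_nat; apply: eq_bigr => r hr.
  by rewrite /s ifT.
rewrite -/g -/v !S -(grid_dw m0 cba w) -/h -/L -/U.
rewrite (@sum_split _ 0 3 h) // (_ : \sum_(3 <= r < h) _ =
  \sum_(2 <= r < h.-1) cycle_weight w (line U L r.+1)); first by lia.
by rewrite -{1}(prednK (n := h)) ?big_add1 //; lia.
Qed.

(** As [b] generates Z_m, all columns lie on one cycle, [a] steps apart. Since [g] divides [a] and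
    [m - a.*2], each of the three segments has room for the gadget with its [g.-1] squares. *)
Lemma two_ham_unit m a b : odd m -> coprime b m -> 0 < a -> a.*2 < m -> 1 < gcdn a m ->
  two_ham m (a * b) b.
Proof.
move=> om cb a0 am g1; have m0 : 0 < m by case: m om {cb am g1}.
have cab : coprime (gcdn (a * b) b) m by rewrite (gcdnC (a * b)) gcdnMl.
have cba : coprime (gcdn b (a * b)) m by rewrite gcdnMl.
have Eg : gcdn (a * b) m = gcdn a m by rewrite gcdnC Gauss_gcdl 1?coprime_sym // gcdnC.
have Eb : gcdn b m = 1 by exact/eqP.
have rows_cols := rows_cols m (a * b); rewrite Eg in rows_cols.
have ga := dvdn_gcdl a m; have gm := dvdn_gcdr a m.
have og : odd (gcdn a m) by exact: dvdn_odd om.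
have le_ga := dvdn_leq a0 ga.
have le_g : gcdn a m <= m - a.*2.
  by apply: dvdn_leq; rewrite ?subn_gt0 // dvdn_sub // -muln2 dvdn_mulr.
set g := gcdn a m in g1 rows_cols og le_ga le_g Eg; set M := m %/ g in rows_cols.
have M3 : 2 < M.
  rewrite -(ltn_pmul2l (m := g)) ?rows_cols; last by apply: ltn_trans g1.
  by move: le_g le_ga am; clear; lia.
pose K := (g - 3)./2; have EK : g.-1 = K.*2.+2.
  by move: og g1; rewrite /K; clear; lia.
have [||A pA WA] := @tree_cycle m (a * b) b m0 cab (fun r => odd r : nat).
- by move=> r _; rewrite Eg -/M; case: (odd r) => //; apply: ltn_trans M3.
- by move=> r _ /=; case: (odd r).
pose f j := (j * b) %% m.
have vE j i : f (j + i * a) = grid m (a * b) b j i by rewrite /f /grid mulnDl mulnA.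
have fE : line (grid m b (a * b)) m 0 = [seq f j | j <- iota 0 m].
  by apply: eq_map => j; rewrite /grid /f mul0n add0n.
have [|||B [pB WB]] := @base_cycle1 f m a K.
- by move: EK le_ga g1; clear; lia.
- by move: EK le_g g1; clear; lia.
- by rewrite /f mul0n mod0n modnMr.
have G1 := grid_perm m0 cba; rewrite Eb divn1 /= cats0 fE in G1.
exists A, B; split=> //; first exact: perm_trans pB G1.
move=> w sw; have := WA w sw; have := WB w sw.
rewrite -(grid_dw m0 cba w) Eb divn1 big_nat1 cycle_weight_line //; last first.
  by rewrite /grid !mul0n !add0n mod0n modnMr.
rewrite Eg EK.
have -> : \sum_(0 <= r < K.*2.+2) ver (fun j i => f (j + i * a)) w r (odd r) =
   \sum_(0 <= r < K.*2.+2) ver (grid m (a * b) b) w r (odd r).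
  by apply: eq_bigr => r _; rewrite /ver !vE.
have -> : \sum_(0 <= r < K.*2.+2) hor (fun j i => f (j + i * a)) w r (odd r) =
   \sum_(0 <= r < K.*2.+2) hor (grid m (a * b) b) w r (odd r).
  by apply: eq_bigr => r _; rewrite /hor !vE.
have -> : \sum_(0 <= t < m) w (grid m b (a * b) 0 t) (grid m b (a * b) 0 t.+1) =
   \sum_(0 <= j < m) w (f j) (f j.+1).
  by apply: eq_bigr => j _; rewrite /grid /f !mul0n !add0n.
by clear; lia.
Qed.

Lemma diff_weight_mod m w d : diff_weight m w (d %% m) = diff_weight m w d.
Proof. by apply: eq_bigr => x _; rewrite modnDmr. Qed.

Lemma perm_shift m d : 0 < m -> perm_eq [seq (x + d) %% m | x <- iota 0 m] (iota 0 m).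
Proof.
move=> m0; have un : uniq [seq (x + d) %% m | x <- iota 0 m].
  rewrite map_inj_in_uniq ?iota_uniq // => x y; rewrite !mem_iota /= => xm ym /eqP.
  by rewrite eqn_modDr !modn_small // => /eqP.
apply: uniq_perm => //; first exact: iota_uniq.
have sub : {subset [seq (x + d) %% m | x <- iota 0 m] <= iota 0 m}.
  by move=> x /mapP[y _ ->]; rewrite mem_iota /= ltn_mod.
by have [] := uniq_min_size un sub; rewrite ?size_map ?size_iota.
Qed.

Lemma diff_weight_opp m w d : sym w -> 0 < m -> d <= m -> diff_weight m w (m - d) = diff_weight m w d.
Proof.
move=> sw m0 dm; rewrite /diff_weight -(perm_big _ (perm_shift d m0)) big_map big_seq [RHS]big_seq.
apply: eq_bigr => x; rewrite mem_iota /= => xm.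
by rewrite modnDml -addnA subnKC // modnDr (modn_small xm) sw.
Qed.

Lemma two_hamC m a b : two_ham m a b -> two_ham m b a.
Proof.
by case=> A [B [pA pB W]]; exists B, A; split=> // w sw; rewrite addnC W // addnC.
Qed.

(** Two gcds with [m] that are both above 1 are coprime, hence different. If [b] is a unit, [a] is
    written as [c * b], with [c] replaced by [m - c] beyond m/2, since opposite differences give the
    same edges. *)
Lemma two_ham_exists m a b : odd m -> 0 < a < m -> 0 < b < m ->
  coprime (gcdn a b) m -> two_ham m a b.
Proof.
move=> om; wlog hg : a b / gcdn b m <= gcdn a m.
  move=> H am bm cab; case/orP: (leq_total (gcdn b m) (gcdn a m)) => h; first exact: H.
  by apply: two_hamC; apply: H => //; rewrite gcdnC.
move=> /andP[a0 am] /andP[b0 bm] cab; have m0 : 0 < m by apply: leq_ltn_trans am.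
have og : odd (gcdn a m) by apply: dvdn_odd om; apply: dvdn_gcdr.
have oh : odd (gcdn b m) by apply: dvdn_odd om; apply: dvdn_gcdr.
have [h1|h1] := eqVneq (gcdn b m) 1; last first.
  have h3 : 3 <= gcdn b m by case: (gcdn b m) oh h1 => [|[|[]]].
  apply: two_ham_large => //; rewrite h3 ltn_neqAle hg andbT; apply/eqP => E.
  move: cab; rewrite /coprime -{1}[m]gcdnn gcdnACA -E gcdnn => /eqP E1.
  by rewrite E1 in h3.
have cb : coprime b m by exact/eqP.
have [g1|g1] := eqVneq (gcdn a m) 1.
  have [A pA WA] := single_ham m0 (introT eqP g1); have [B pB WB] := single_ham m0 cb.
  by exists A, B; split=> // w sw; rewrite WA // WB.
have g2 : 1 < gcdn a m by case: (gcdn a m) og g1 => [|[]].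
have [u Eu] : exists u, (u * b) %% m = 1 %% m.
  case: (egcdnP m b0) => u v E _; exists u.
  by rewrite E (eqP cb) modnMDl.
pose c := (a * u) %% m; have cm : c < m by rewrite ltn_mod.
have Ec : (c * b) %% m = a.
  by rewrite modnMml -mulnA -modnMmr Eu modnMmr muln1 modn_small.
have c0 : 0 < c by case: (c) Ec a0 => //; rewrite mul0n mod0n => <-.
have c1 : 0 < m - c by rewrite subn_gt0.
have gc : gcdn c m = gcdn a m.
  by rewrite -[in RHS]Ec gcdn_modl gcdnC [RHS]gcdnC Gauss_gcdl // coprime_sym.
have [lt|ge] := ltnP c.*2 m.
  have [|A [B [pA pB W]]] := two_ham_unit om cb c0 lt; first by rewrite gc.
  exists A, B; split=> // w sw; rewrite W //; congr (_ + _).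
  by rewrite -diff_weight_mod Ec.
have lt : (m - c).*2 < m by move: ge cm om; clear; lia.
have [|A [B [pA pB W]]] := two_ham_unit om cb c1 lt.
  have Esum : c + (m - c) = m by rewrite subnKC // ltnW.
  suff -> : gcdn (m - c) m = gcdn c m by rewrite gc.
  have : gcdn (m - c) (c + (m - c)) = gcdn c (c + (m - c)) by rewrite gcdnDr gcdnDl gcdnC.
  by rewrite Esum.
exists A, B; split=> // w sw; rewrite W //; congr (_ + _).
rewrite -[RHS](diff_weight_opp sw m0 (ltnW am)) -diff_weight_mod -[RHS]diff_weight_mod; congr (diff_weight m w _).
apply/eqP; rewrite -(eqn_modDr a) subnK ?(ltnW am) // -{1}Ec modnDmr -mulnDl.
by rewrite subnK ?(ltnW cm) // modnMr modnn.
Qed.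

Definition diff_arcs m d :=
  [seq (x, (x + d) %% m) | x <- iota 0 m] ++ [seq ((x + d) %% m, x) | x <- iota 0 m].

Definition hams m ds Cs := [/\ size Cs = size ds,
  {in Cs, forall c, perm_eq c (iota 0 m)} &
  forall w, sym w -> \sum_(c <- Cs) cycle_weight w c = \sum_(d <- ds) diff_weight m w d].

(** The bound keeps the largest difference, [s + n.*2 - 1], below m/2. *)
Lemma hams_pairs m n s : odd m -> 0 < s -> s.*2 + (n.*2).*2 < m + 2 ->
  exists Cs, hams m (iota s n.*2) Cs.
Proof.
move=> om; elim: n s => [|n IH] s s0 sm.
  by exists [::]; split=> // w _; rewrite !big_nil.
have [||Cs [sz pC W]] := IH s.+2; [by [] | lia |].
have [|||A [B [pA pB WAB]]] := @two_ham_exists m s s.+1 om; try lia.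
  by rewrite (eqP (coprimenS s)) coprime1n.
exists [:: A, B & Cs]; split; first by rewrite /= sz !size_iota.
  by move=> c; rewrite !in_cons => /orP[/eqP->//|/orP[/eqP->//|/pC]].
move=> w sw; rewrite doubleS !big_cons W //.
by rewrite !addnA WAB.
Qed.

Lemma hams_exist m : odd m -> 5 <= m -> exists Cs, hams m (iota 3 (m./2 - 2)) Cs.
Proof.
move=> om m5; have mE := odd_double_half m; rewrite om in mE.
set k := m./2 in mE *; have kE := odd_double_half (k - 2).
have [|Cs [sz pC W]] := @hams_pairs m (k - 2)./2 3 om isT.
  by move: mE kE m5; clear; case: odd; lia.
case: (odd _) kE => kE; last first.
  by exists Cs; rewrite -kE.
(* An odd number of differences leaves the last one, [k], unpaired; it is a unit because [m] is
   [k.*2 + 1]. *)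
have ck : coprime k m by rewrite /coprime -mE addnC -muln2 mulnC gcdnMDl gcdn1.
have [|c pc Wc] := @single_ham m k _ ck; first by lia.
exists (c :: Cs); split.
- by rewrite /= sz !size_iota; lia.
- by move=> x; rewrite in_cons => /orP[/eqP->//|/pC].
move=> w sw; rewrite big_cons W // Wc //.
suff -> : iota 3 (k - 2) = iota 3 (k - 2)./2.*2 ++ [:: k].
  by rewrite big_cat big_seq1 addnC.
rewrite -{1}kE addnC iotaD; congr (_ ++ [:: _]).
by move: kE m5 mE; clear; lia.
Qed.

Lemma count_diff_arcs P m d :
  count P (diff_arcs m d) = diff_weight m (fun x y => P (x, y) + P (y, x)) d.
Proof.
rewrite /diff_arcs count_cat !count_map /diff_weight big_split /=.
by congr (_ + _); rewrite -sum1_count big_mkcond /=; apply: eq_bigr => x _ /=; case: (P _).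
Qed.

Lemma mem_diff_arcs m d e : 0 < d -> d.*2 < m -> e \in diff_arcs m d ->
  bdiff m e.1 e.2 = d \/ bdiff m e.1 e.2 = m - d.
Proof.
move=> d0 dm; have m0 : 0 < m by lia.
rewrite /diff_arcs mem_cat => /orP[] /mapP[x]; rewrite mem_iota /= => xm -> /=.
  left; have := @bdiff_shift m x 0 d m0 isT.
  by rewrite addn0 (modn_small xm) => ->; rewrite subn0 modnDr modn_small //; lia.
right; have := @bdiff_shift m x d 0 m0.
by rewrite addn0 (modn_small xm) => ->; rewrite ?add0n ?modn_small //; lia.
Qed.

Lemma uniq_diff_arcs m d : 0 < d -> d.*2 < m -> uniq (diff_arcs m d).
Proof.
move=> d0 dm; have m0 : 0 < m by lia.
rewrite /diff_arcs cat_uniq !map_inj_uniq ?iota_uniq //; last 2 first.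
- by move=> x y [].
- by move=> x y [].
rewrite andbT; apply/hasPn => e /mapP[x]; rewrite mem_iota /= => xm ->.
apply/mapP => -[y]; rewrite mem_iota /= => ym [E1 E2].
have := @bdiff_shift m y 0 d m0 isT; rewrite addn0 (modn_small ym) -E2 -[X in bdiff _ X _]E1.
have := @bdiff_shift m x d 0 m0; rewrite addn0 (modn_small xm) add0n => ->; last by lia.
by rewrite subn0 modnDr !modn_small; lia.
Qed.

Lemma ham_cycles m : odd m -> 5 <= m -> exists Cs, [/\ size Cs = m./2 - 2,
  {in Cs, forall c, perm_eq c (iota 0 m)}, uniq (flatten (map (@sym_arcs nat) Cs)) &
  {in flatten (map (@sym_arcs nat) Cs), forall e,
    bdiff m e.1 e.2 \notin [:: 0; 1; 2; m.-1; m.-2]}].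
Proof.
move=> om m5; have mE := odd_double_half m; rewrite om in mE.
have [Cs [sz pC W]] := hams_exist om m5; exists Cs.
have pD : perm_eq (flatten (map (@sym_arcs nat) Cs))
                  (flatten (map (diff_arcs m) (iota 3 (m./2 - 2)))).
  apply/permP => P; rewrite !count_flatten -!map_comp !sumnE !big_map /=.
  rewrite (eq_bigr _ (fun d _ => count_diff_arcs P m d)) -W; last by move=> x y; rewrite addnC.
  by apply: eq_bigr => c _; apply: cycle_weight_sym_arcs.
split=> //; first by rewrite sz size_iota.
  rewrite (perm_uniq pD); apply: uniq_flatten_map; first exact: iota_uniq.
    by move=> d; rewrite mem_iota => hd; apply: uniq_diff_arcs; lia.
  move=> d d'; rewrite !mem_iota => hd hd' e.
  by move=> /mem_diff_arcs h /mem_diff_arcs h'; move: h h'; lia.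
move=> e; rewrite (perm_mem pD) => /flatten_mapP[d]; rewrite mem_iota => hd.
move=> /mem_diff_arcs h; rewrite !inE; have h1 : 0 < d by lia.
have h2 : d.*2 < m by lia.
by case: (h h1 h2) => ->; lia.
Qed.

(** * Decompositions of the complete symmetric digraph *)

Lemma pack_all m Cs lam : 3 <= m -> {in Cs, forall c, perm_eq c (iota 0 m)} ->
  uniq (flatten (map (@sym_arcs nat) Cs)) -> all (leq 1) lam -> sumn lam = m ->
  exists Fs : seq (seq (seq nat)), [/\ size Fs = 4 * size Cs,
    {in Fs, forall cs, perm_eq (flatten cs) (iota 0 m.*2) /\
                       perm_eq (map size cs) (map double lam)},
    uniq (flatten (map (@factor_arcs nat) Fs)) &
    {in flatten (map (@factor_arcs nat) Fs), forall e,
       (e.1./2, e.2./2) \in flatten (map (@sym_arcs nat) Cs)}].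
Proof.
move=> m3 + + l1 El; elim: Cs => [|C Cs IH] pC; first by exists [::].
rewrite /= cat_uniq => /and3P[uC dis uCs].
have [|//|Fs [sF pF uF aF]] := IH; first by move=> c hc; apply: pC; rewrite in_cons hc orbT.
have [Gs [sG pG uG aG]] := pack_exists m3 (pC C (mem_head _ _)) l1 El.
exists (Gs ++ Fs); split.
- by rewrite size_cat sG sF mulnS.
- by move=> cs; rewrite mem_cat => /orP[/pG|/pF].
- rewrite map_cat flatten_cat cat_uniq uG uF andbT /=; apply/hasPn => e /aF h.
  by apply: contra (hasPn dis _ h) => /aG.
- by move=> e; rewrite map_cat flatten_cat mem_cat mem_cat => /orP[/aG->|/aF->]; rewrite ?orbT.
Qed.

(** The nine strip factors have only [near] arcs, and the factors over the Hamilton cycles have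
    none, so the two families are disjoint. *)
Lemma OP_large m lam F : 5 <= m -> odd m -> all (leq 1) lam -> sumn lam = m ->
  isomorphic F (disjoint_dicycles (map double lam)) -> OP_solvable m.*2 F.
Proof.
move=> m5 om l1 El isoF.
have [|Fs [sF pF uF aF]] := @strip_factors m lam m5 El; first by apply: tiled_all; rewrite ?El.
have [Cs [sC pC uC aC]] := ham_cycles om m5.
have [|Gs [sG pG uG aG]] := pack_all _ pC uC l1 El; first by apply: leq_trans m5.
have p cs : cs \in Fs ++ Gs -> perm_eq (flatten cs) (iota 0 m.*2) /\
                       perm_eq (map size cs) (map double lam).
  by rewrite mem_cat => /orP[/pF|/pG].
apply: (OP_of_cycles (Fs := Fs ++ Gs) isoF).
- by rewrite all_map; apply: sub_all l1 => l /=; lia.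
- by lia.
- by rewrite size_cat sF sG sC; have := odd_double_half m; rewrite om; lia.
- by move=> cs /p[].
- by move=> cs /p[].
rewrite map_cat flatten_cat cat_uniq uF uG andbT /=; apply/hasPn => e /aG /aC h.
by apply: contra h => /aF.
Qed.

Definition factors24 : seq (seq (seq nat)) :=
  [:: [:: [:: 0; 1]; [:: 2; 5; 3; 4]]; [:: [:: 0; 2]; [:: 1; 5; 4; 3]];
      [:: [:: 0; 3]; [:: 1; 4; 5; 2]]; [:: [:: 0; 4]; [:: 1; 2; 3; 5]];
      [:: [:: 0; 5]; [:: 1; 3; 2; 4]]].

Definition factors222 : seq (seq (seq nat)) :=
  [:: [:: [:: 0; 1]; [:: 2; 3]; [:: 4; 5]]; [:: [:: 0; 2]; [:: 1; 4]; [:: 3; 5]];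
      [:: [:: 0; 3]; [:: 1; 5]; [:: 2; 4]]; [:: [:: 0; 4]; [:: 1; 3]; [:: 2; 5]];
      [:: [:: 0; 5]; [:: 1; 2]; [:: 3; 4]]].

Lemma OP_of_list n mm F Fs : isomorphic F (disjoint_dicycles mm) ->
  [&& all (leq 2) mm, 0 < n, size Fs == n.-1,
      all (fun cs => perm_eq (flatten cs) (iota 0 n) && perm_eq (map size cs) mm) Fs
    & uniq (flatten (map (@factor_arcs nat) Fs))] -> OP_solvable n F.
Proof.
move=> isoF /and5P[h1 h2 /eqP h3 /allP h4 h5].
by apply: (OP_of_cycles (Fs := Fs) isoF) => // cs /h4 /andP[].
Qed.

Lemma OP_small m lam F : odd m -> m < 5 -> all (leq 1) lam -> sumn lam = m ->
  isomorphic F (disjoint_dicycles (map double lam)) ->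
  ~ isomorphic F (disjoint_dicycles [:: 6]) -> OP_solvable m.*2 F.
Proof.
move=> om m5 l1 El.
have : lam \in [:: [:: 1]; [:: 3]; [:: 1; 2]; [:: 2; 1]; [:: 1; 1; 1]].
  case: m om m5 El => [|[|[|[|[|?]]]]] // _ _.
    by case: lam l1 => [|[|[|?]] [|[|?] ?]] //= => /andP[].
  case: lam l1 => [|[|[|[|[|?]]]] [|[|[|[|?]]] [|[|[|?]] [|[|?] ?]]]] //=;
  by rewrite ?andbF.
rewrite -El !inE => /or4P[|||/orP[]] /eqP-> /= isoF nF.
- by apply: (OP_of_list (Fs := [:: [:: [:: 0; 1]]]) isoF).
- by [].
- by apply: (OP_of_list (Fs := factors24) isoF).
- by apply: (OP_of_list (Fs := factors24) isoF).
- by apply: (OP_of_list (Fs := factors222) isoF).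
Qed.

(** * The directed 6-cycle *)

(** A factor is labelled by the out-neighbour [k] of the vertex 0; this removes the symmetry among
    the five factors from the search. *)
Definition hexes k := [seq [:: 0, k & q] | q <- permutations [seq x <- iota 1 5 | x != k]].

(* The conditional, unlike a conjunction, prunes the search under call by value. *)
Fixpoint search ks (used : seq (nat * nat)) :=
  if ks is k :: ks' then
    has (fun c => if has (mem used) (cycle_arcs c) then false else search ks' (cycle_arcs c ++ used))
      (hexes k)
  else true.

(** Soundness of a failing search: disjoint sets [S k], each containing a candidate cycle, mark a
    branch that succeeds. *)
Lemma searchP (S : nat -> pred (nat * nat)) ks used : uniq ks ->
  {in ks, forall k, exists2 c, c \in hexes k & {subset cycle_arcs c <= S k}} ->
  {in ks &, forall k l e, S k e -> S l e -> k = l} ->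
  {in ks, forall k, {in used, forall e, ~~ S k e}} -> search ks used.
Proof.
elim: ks used => //= k ks IH used /andP[kks uks] hS dS uS.
have [c ck cS] := hS k (mem_head _ _).
apply/hasP; exists c => //; rewrite ifN; last first.
  apply/hasPn => e /cS h; apply: contraL h => he.
  exact: uS (mem_head _ _) _ he.
apply: IH => //.
- by move=> l hl; apply: hS; rewrite in_cons hl orbT.
- by move=> l l' hl hl'; apply: dS; rewrite in_cons ?hl ?hl' orbT.
move=> l hl e; rewrite mem_cat => /orP[/cS h|he].
  apply/negP => h'; move: kks; rewrite (dS k l _ _ e h h') ?hl ?mem_head //.
  by rewrite in_cons hl orbT.
by apply: uS => //; rewrite in_cons hl orbT.
Qed.

Lemma search_fails : search (iota 1 5) [::] = false.
Proof. by vm_compute. Qed.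

Lemma hex_of_block (A : {set 'I_6 * 'I_6}) (k : 'I_6) :
  isomorphic (@spanning_subdigraph (complete_symmetric 6) A) (disjoint_dicycles [:: 6]) ->
  (ord0, k) \in A -> k != ord0 ->
  exists2 c, c \in hexes k &
    {subset cycle_arcs c <= [pred e | [exists a in A, (val a.1, val a.2) == e]]}.
Proof.
case=> f [g fK gK] fA kA k0.
pose i0 : 'I_(size [:: 6]) := Ordinal (isT : 0 < size [:: 6]).
(* Reducing the index modulo 6 makes the walk periodic, so it can start at the image of vertex 0
   wherever that lies. *)
pose pt (j : nat) : disjoint_dicycles [:: 6] :=
  existT (fun i : 'I_(size [:: 6]) => 'I_(nth 0 [:: 6] i)) i0 (inord (n' := 5) (j %% 6)).
have ptE x : exists2 j, j < 6 & x = pt j.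
  case: x => -[[|//] lt] j.
  move: j; rewrite (bool_irrelevance lt isT) => j; exists j => //.
  by apply: (congr1 (existT _ _)); apply: val_inj; rewrite /= inordK modn_small.
have pt_mod j : pt (j %% 6) = pt j by rewrite /pt modn_mod.
have pt_inj i j : i < 6 -> j < 6 -> pt i = pt j -> i = j.
  move=> hi hj /(congr1 (fun x : disjoint_dicycles [:: 6] => val (tagged x))) /=.
  by rewrite !inordK ?modn_small.
have pt_arc i j : Defs.arc (pt i) (pt j) = (j == i.+1 %[mod 6]).
  by rewrite /= !inordK ?ltn_mod // -[(i %% 6).+1]addn1 modnDml addn1.
have [j0 j06 Ej0] := ptE (f ord0).
pose c := [seq val (g (pt (j0 + i))) | i <- iota 0 6].
have Ek : val k = val (g (pt j0.+1)).
  have [j1 j16 Ej1] := ptE (f k).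
  have := fA ord0 k; rewrite Ej0 Ej1 pt_arc [RHS]kA => /eqP E.
  by rewrite -pt_mod -E pt_mod -Ej1 fK.
have gA i : (g (pt i), g (pt i.+1)) \in A.
  by rewrite -[_ \in A]/(Defs.arc (g (pt i)) (g (pt i.+1))) -fA !gK pt_arc.
have c0 : perm_eq c (iota 0 6).
  have un : uniq c.
    rewrite map_inj_in_uniq ?iota_uniq // => x y; rewrite !mem_iota /= => hx hy.
    move=> /val_inj /(can_inj gK) E; apply/eqP; rewrite -(modn_small hx) -(modn_small hy).
    rewrite -(eqn_modDl j0); apply/eqP; apply: pt_inj; rewrite ?ltn_mod //.
    by rewrite !pt_mod.
  apply: uniq_perm => //.
  have sub : {subset c <= iota 0 6} by move=> x /mapP[y _ ->]; rewrite mem_iota /=; apply: ltn_ord.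
  by have [] := uniq_min_size un sub; rewrite ?size_map ?size_iota.
exists c.
  have Ec : c = [:: 0, val k & [seq val (g (pt (j0 + i))) | i <- iota 2 4]].
    by rewrite /c /= addn0 addn1 -Ej0 fK -Ek.
  rewrite Ec; apply/mapP; eexists; last by [].
  rewrite mem_permutations; set q := map _ (iota 2 4) in Ec *; clearbody q.
  have pq : perm_eq (val k :: q) (iota 1 5) by rewrite -(perm_cons 0) -Ec.
  have E : [seq x <- val k :: q | x != val k] = q.
    rewrite /= eqxx /=. apply/all_filterP.
    have : uniq (val k :: q) by rewrite (perm_uniq pq).
    by case/andP=> kq _; apply/allP => x xq; apply: contraNneq kq => E; move: xq; rewrite E.
  by rewrite -E; exact: (perm_filter (fun x => x != val k) pq).
move=> e /(mem_cycle_arcsP 0)[j]; rewrite size_map size_iota => j6 ->.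
apply/existsP; exists (g (pt (j0 + j)), g (pt (j0 + j).+1)); rewrite gA /=.
rewrite !(nth_map 0) ?size_iota ?ltn_mod // !nth_iota ?ltn_mod // !add0n.
rewrite -[pt (j0 + j).+1]pt_mod -[pt (j0 + _ %% _)]pt_mod modnDmr addnS.
by rewrite eqxx.
Qed.

(** A block exists because [n > 1], and its 6 vertices force [n = 6]. The blocks of the arcs from 0
    to different [k] are different, since 0 has one out-neighbour in each block; so they would make
    the search succeed. *)
Lemma no_OP_hexagon n F : 1 < n -> isomorphic F (disjoint_dicycles [:: 6]) ->
  ~ OP_solvable n F.
Proof.
move=> n1 isoF [P [pP isoP]].
have isoP6 A : A \in P -> isomorphic (spanning_subdigraph A) (disjoint_dicycles [:: 6]).
  by move=> /isoP h; apply: isomorphic_trans isoF.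
have [cP tP _] := and3P pP; move/eqP: cP => cP.
have in_cover (a : 'I_n * 'I_n) : a.1 != a.2 -> a \in cover P by rewrite cP inE.
have n6 : n = 6.
  have h01 : Ordinal (ltnW n1) != Ordinal n1 by [].
  have := in_cover (_, _) h01; rewrite -mem_pblock => /[dup] h _.
  have /isoP6[f bf _] := pblock_mem (in_cover (_, _) h01).
  have := bij_eq_card bf; rewrite card_ord => ->.
  by rewrite card_tagged /= enum_ordSl (size0nil (size_enum_ord 0)) /= card_ord addn0.
subst n.
pose S k : pred (nat * nat) :=
  [pred e | [exists a in pblock P (ord0 : 'I_6, inord k : 'I_6), (val a.1, val a.2) == e]].
have := search_fails; rewrite (@searchP S) //.
- move=> k; rewrite mem_iota => hk.
  have k0 : inord k != ord0 :> 'I_6 by rewrite -val_eqE /= inordK; lia.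
  have kin : (ord0 : 'I_6, inord k : 'I_6) \in cover P.
    by apply: in_cover; rewrite eq_sym.
  have := @hex_of_block _ _ (isoP6 _ (pblock_mem kin)) _ k0.
  rewrite inordK; last by lia.
  by apply; rewrite mem_pblock.
move=> k l; rewrite !mem_iota => hk hl e /existsP[a /andP[ak /eqP ea]] /existsP[b /andP[bl /eqP eb]].
have kin (i : nat) : 1 <= i < 6 -> (ord0 : 'I_6, inord i : 'I_6) \in cover P.
  by move=> hi; apply: in_cover; rewrite /= eq_sym -val_eqE /= inordK; lia.
have Eab : a = b.
  case: a b ea eb {ak bl} => a1 a2 [b1 b2] /= <- [] /val_inj -> /val_inj -> //.
have Ebl : pblock P (ord0 : 'I_6, inord k : 'I_6) = pblock P (ord0 : 'I_6, inord l : 'I_6).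
  have hkP := pblock_mem (kin k hk); have hlP := pblock_mem (kin l hl).
  by rewrite -(def_pblock tP hkP ak) -(def_pblock tP hlP bl) Eab.
have [f bf fA] := isoP6 _ (pblock_mem (kin k hk)).
have h1 : (ord0 : 'I_6, inord k : 'I_6) \in pblock P (ord0 : 'I_6, inord k : 'I_6).
  by rewrite mem_pblock kin.
have h2 : (ord0 : 'I_6, inord l : 'I_6) \in pblock P (ord0 : 'I_6, inord k : 'I_6).
  by rewrite Ebl mem_pblock kin.
have e1 := fA ord0 (inord k); have e2 := fA ord0 (inord l).
move: e1 e2; rewrite [RHS]h1 => e1; rewrite [RHS]h2 => e2.
suff : inord k = inord l :> 'I_6 by move/(congr1 val); rewrite /= !inordK; lia.
apply: (bij_inj bf); move: e1 e2; clear.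
case: (f ord0) (f (inord k)) (f (inord l)) => i x [j y] [h z] /= /andP[/eqP ij /eqP yx] /andP[/eqP ih /eqP zx].
subst j h; congr existT; apply: val_inj; by rewrite /= yx zx.
Qed.

Theorem theorem1p5 (n : nat) (F : digraph)
  (hn : n = 2 %[mod 4])
  (hF : bipartite_directed_2factor n F) :
  OP_solvable n F <-> ~ isomorphic F (disjoint_dicycles [:: 6]).
Proof.
have nE := divn_eq n 4; rewrite hn modn_small // in nE.
split.
  by move=> sol isoF; apply: no_OP_hexagon sol => //; lia.
case: hF => mm [[m2 isoF] sm em] nF.
pose lam := map half mm.
have mmE : mm = map double lam.
  rewrite /lam -map_comp -[LHS]map_id; apply/eq_in_map => k /(allP em) /=.
  by move=> /even_halfK.
have l1 : all (leq 1) lam by rewrite all_map; apply: sub_all m2 => k /=; lia.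
have sE : n = (sumn lam).*2.
  by rewrite -sm mmE !sumnE !big_map -mul2n big_distrr; apply: eq_bigr => i _ /=; lia.
have om : odd (sumn lam) by move: nE; rewrite sE; lia.
rewrite mmE in isoF; rewrite sE.
have [h|h] := ltnP (sumn lam) 5; first exact: OP_small isoF nF.
exact: OP_large isoF.
Qed.
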